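(* Let $n$ be a positive integer and let $p=p(n)\in(0,1]$. Let $F(n,p)$ be the number of faces in a random embedding of a random graph $G\sim G(n,p)$. Then $$\mathbb{E}[F(n,p)]\le H_n^2+\frac1p,$$ where $H_n=\sum_{j=1}^n\frac1j$.
   Context: $G(n,p)$ is the random graph on $n$ labelled vertices in which each of the $\binom n2$ possible edges is present independently with probability $p$. A random embedding of a graph $G$ is given by choosing, independently and uniformly for each vertex $v$ of positive degree, a cyclic permutation $R_v$ (a single cycle) of the darts at $v$, where a dart is a pair $(v,e)$ with $e$ an edge incident with $v$. With $R$ the product of all $R_v$ and $L$ the involution on darts swapping the two darts of each edge, the faces of a connected component with at least one edge are the cycles of $R\circ L$ consisting of darts of that component; an isolated vertex has exactly one face. For a possibly disconnected embedded graph, the number of faces is defined as the sum of the numbers of faces of its connected components, minus the number of connected components, plus one. In $F(n,p)$ the randomness is over both the graph $G\sim G(n,p)$ and the random embedding of $G$. *)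

(* Defs.v *)
From HB Require Import structures.
From mathcomp Require Import all_boot all_order all_algebra all_fingroup.
From mathcomp Require Import reals.

Set Implicit Arguments.
Unset Strict Implicit.
Unset Printing Implicit Defensive.

Import Order.TTheory GRing.Theory Num.Theory.

Record edge (n : nat) := Edge { ends : {set 'I_n}; _ : #|ends| == 2 }.
HB.instance Definition _ (n : nat) := [isSub for @ends n].
HB.instance Definition _ (n : nat) := [Finite of edge n by <:].

(* A simple graph on the vertex set 'I_n is given by its set of edges. *)
Notation graph n := {set edge n}.

(* The pairs (v, e) with v not in e, or e not in the graph, are junk values:
   see [darts]. *)
Notation dart n := ('I_n * edge n)%type.

Section Embedding.
Variable n : nat.
Implicit Types (G : graph n) (d : dart n) (v w : 'I_n) (C : {set 'I_n}).

Definition darts G : {set dart n} :=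
  [set d : dart n | (d.2 \in G) && (d.1 \in ends d.2)].

Definition darts_at G v : {set dart n} := [set d in darts G | d.1 == v].

(* Cyclic permutations of the darts at v, extended by the identity to all of
   [dart n].  If v has degree 0, the identity is the only element. *)
Definition rotations_at G v : {set {perm dart n}} :=
  [set s : {perm dart n} | perm_on (darts_at G v) s
     && [forall d in darts_at G v, porbit s d == darts_at G v]].

(* The factors have disjoint supports, so their order is irrelevant. *)
Definition rotation (r : {ffun 'I_n -> {perm dart n}}) : {perm dart n} :=
  (\prod_(v : 'I_n) r v)%g.

Definition opposite v (e : edge n) : 'I_n :=
  odflt v [pick w in ends e :\ v].

Definition flip_fun G d : dart n :=
  if d \in darts G then (opposite d.1 d.2, d.2) else d.

Lemma flip_funK G : involutive (flip_fun G).
Proof.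
move=> [v e]; rewrite /flip_fun.
have [|/negPf nd] := boolP ((v, e) \in darts G); last by rewrite nd.
rewrite inE /= => /andP[eG ve].
have [w wv ew] : exists2 w, w != v & ends e = [set v; w].
  have /cards2P[x [y [xy exy]]] := valP e; rewrite /= in exy.
  move: ve; rewrite exy !inE => /orP[]/eqP->.
    by exists y; first rewrite eq_sym.
  by exists x; last rewrite setUC.
have opp x y : x != y -> ends e = [set y; x] -> opposite y e = x.
  move=> xy exy; rewrite /opposite; case: pickP => [z|/(_ x)] /=.
    by rewrite exy !inE => /andP[/negPf->] /= /eqP.
  by rewrite exy !inE xy eqxx orbT.
rewrite (opp _ _ wv ew) inE /= eG ew !inE eqxx orbT /=.
by rewrite (opp v w) // 1?eq_sym // setUC.
Qed.

Definition flip G : {perm dart n} := perm (can_inj (flip_funK G)).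

Definition adjacent G : rel 'I_n :=
  [rel v w | [exists e in G, ends e == [set v; w]]].

Definition components G : {set {set 'I_n}} :=
  equivalence_partition (connect (adjacent G)) [set: 'I_n].

Definition darts_in G C : {set dart n} := [set d in darts G | d.1 \in C].

(* [(s * t)%g] applies s first, so [(flip G * rotation r)%g] is R \o L. *)
Definition face_cycles G (r : {ffun 'I_n -> {perm dart n}}) C :
    {set {set dart n}} :=
  [set f in porbits (flip G * rotation r)%g | f \subset darts_in G C].

(* A component without darts is an isolated vertex. *)
Definition component_faces G r C : nat :=
  if darts_in G C == set0 then 1 else #|face_cycles G r C|.

Definition faces G r : int :=
  ((\sum_(C in components G) component_faces G r C)%N%:Z
   - #|components G|%:Z + 1)%R.

End Embedding.

Section Expectation.
Local Open Scope ring_scope.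
Variables (R : realType) (n : nat).

Definition gnp_mass (p : R) (G : graph n) : R :=
  \prod_(e : edge n) (if e \in G then p else 1 - p).

(* The R_v are independent, each uniform on [rotations_at G v]. *)
Definition embedding_mass (G : graph n) (r : {ffun 'I_n -> {perm dart n}}) : R :=
  \prod_(v : 'I_n)
    ((r v \in rotations_at G v)%:R / #|rotations_at G v|%:R).

Definition expected_faces (p : R) : R :=
  \sum_(G : graph n) gnp_mass p G *
    \sum_(r : {ffun 'I_n -> {perm dart n}}) embedding_mass G r * (faces G r)%:~R.

Definition harmonic_number : R := \sum_(1 <= j < n.+1) j%:R^-1.

End Expectation.

(* Main.v *)
Require Import Defs.
From mathcomp Require Import all_boot all_order all_algebra all_fingroup.
From mathcomp Require Import reals.
From mathcomp Require Import ring lra zify.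

(* Order the vertices 0, ..., n - 1 and charge every face to its largest
   vertex k.  Given the graph and the rotations at the vertices below k, following
   faces through vertices below k induces a permutation s (a first-return map) of
   the darts at vertices at least k, and the faces charged to k are the cycles of
   s * R_k that stay inside the set of darts at k.  Fixed points of s can be cut
   out of R_k without losing a cycle, unless every dart at k is fixed.  Revealing
   R_k one dart at a time shows that, if D darts at k are moved by s and r of
   these are sent back to k, the expected number of cycles is at most
   r * (1 + H_(D-1)) / D, plus 1 if D = 0.

   D = 0 forces k to have no neighbour above k, an event of probability
   (1 - p)^(n-1-k); summing over k gives 1 / p.

   For u < k <= w, exchanging the edges {u, k} and {u, w} preserves the
   distribution of the graph and of the rotations below k, and it turns a detour
   ending at k through {u, k} into one ending at w.  Hence a moved dart returns to
   k with probability at most 1 / (n - k), so that E[r (1 + H_(D-1)) / D] is at most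
   1 / (n - k) times (1 + H_(n-2)) times the expected fraction of neighbours of k
   lying below k, which is at most k / (n - 1).  Summing over k gives at most
   H_n ^ 2. *)

Set Implicit Arguments.
Unset Strict Implicit.
Unset Printing Implicit Defensive.

Import Order.TTheory GRing.Theory Num.Theory.

(** * First-return permutations *)

Section FirstReturn.
Variable T : finType.
Implicit Types (s t : {perm T}) (W A B : {set T}) (x y : T).

(** The range of the search is long enough, because the power of [s] at its order brings [x] back to
    itself. The count starts at zero, so the return happens at the successor of this value. *)
Definition return_time s W x :=
  find (fun i => (s ^+ i.+1)%g x \in W) (iota 0 #[s]%g).

Definition first_return_fun s W x :=
  if x \in W then (s ^+ (return_time s W x).+1)%g x else x.

Lemma return_timeP s W x : x \in W ->
  (s ^+ (return_time s W x).+1)%g x \in W /\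
  forall i, i < return_time s W x -> (s ^+ i.+1)%g x \notin W.
Proof.
move=> xW; rewrite /return_time; set a := fun i => _.
have hasa : has a (iota 0 #[s]%g).
  apply/hasP; exists #[s]%g.-1.
    by rewrite mem_iota /= add0n prednK ?order_gt0.
  by rewrite /a prednK ?order_gt0 // expg_order perm1.
have lt := hasa; rewrite has_find size_iota in lt.
split=> [|i ilt].
  by have := nth_find 0 hasa; rewrite nth_iota // add0n.
have := before_find 0 ilt; rewrite nth_iota ?(ltn_trans ilt) // add0n.
by move=> /negbT.
Qed.

Lemma first_return_funE s W x i : x \in W -> (s ^+ i.+1)%g x \in W ->
  (forall j, j < i -> (s ^+ j.+1)%g x \notin W) ->
  first_return_fun s W x = (s ^+ i.+1)%g x.
Proof.
move=> xW siW mini; rewrite /first_return_fun xW.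
have [sW mint] := return_timeP s xW.
case: (ltngtP (return_time s W x) i) => [lt|gt|->] //.
  by rewrite (negPf (mini _ lt)) in sW.
by rewrite (negPf (mint _ gt)) in siW.
Qed.

Lemma first_return_fun_stable s W x :
  (first_return_fun s W x \in W) = (x \in W).
Proof.
rewrite {1}/first_return_fun; have [xW|/negPf//] := boolP (x \in W).
by have [] := return_timeP s xW.
Qed.

(** If two points of [W] had the same first return at times i <= j, cancelling powers of [s] would
    put the first point on the orbit of the second after j - i steps, so the second would have
    returned too early unless i = j. *)
Lemma first_return_fun_inj s W : injective (first_return_fun s W).
Proof.
move=> x y eqxy.
have eqW : (x \in W) = (y \in W).
  by rewrite -(first_return_fun_stable s) eqxy first_return_fun_stable.
have [xW|xW] := boolP (x \in W); last first.
  by move: eqxy; rewrite /first_return_fun -eqW (negPf xW).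
have yW : y \in W by rewrite -eqW.
wlog le : x y xW yW eqW eqxy / return_time s W x <= return_time s W y.
  move=> wl; have [le|/ltnW le] := leqP (return_time s W x) (return_time s W y).
    exact: wl.
  by apply/esym/wl.
have [_ mint] := return_timeP s yW.
move: eqxy; rewrite /first_return_fun xW yW.
rewrite -(subnK le); set i := _ - _; rewrite -addnS expgD permM => /perm_inj.
case def_i: i => [|j]; first by rewrite expg0 perm1.
move=> eqx; have := mint j; rewrite -eqx xW => /(_ _)/negP[] //.
by rewrite -(subnK le) -/i def_i ltnS leq_addr.
Qed.

Definition first_return s W : {perm T} := perm (@first_return_fun_inj s W).

Lemma first_returnE s W x i : x \in W -> (s ^+ i.+1)%g x \in W ->
  (forall j, j < i -> (s ^+ j.+1)%g x \notin W) ->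
  first_return s W x = (s ^+ i.+1)%g x.
Proof. by rewrite permE; apply: first_return_funE. Qed.

Lemma first_return_ex s W x : x \in W -> exists i,
  [/\ first_return s W x = (s ^+ i.+1)%g x, (s ^+ i.+1)%g x \in W &
      forall j, j < i -> (s ^+ j.+1)%g x \notin W].
Proof.
move=> xW; exists (return_time s W x); rewrite permE /first_return_fun xW.
by have [] := return_timeP s xW.
Qed.

Lemma first_return_stable s W x : (first_return s W x \in W) = (x \in W).
Proof. by rewrite permE first_return_fun_stable. Qed.

Lemma first_return_out s W x : x \notin W -> first_return s W x = x.
Proof. by rewrite permE /first_return_fun => /negPf->. Qed.

(** Since [t] moves only points of [W], the orbits of [s] and [s * t] agree until the return, and
    [t] acts once, at the return itself. *)
Lemma first_return_mulr s t W : perm_on W t ->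
  first_return (s * t) W = (first_return s W * t)%g.
Proof.
move=> tW; apply/permP=> x; rewrite permM.
have [xW|xW] := boolP (x \in W); last first.
  by rewrite !first_return_out // (out_perm tW).
have [i [-> siW mini]] := first_return_ex s xW.
have agree j : j <= i -> ((s * t) ^+ j)%g x = (s ^+ j)%g x.
  elim: j => [|j IHj] ji; first by rewrite !expg0.
  have sjW : s ((s ^+ j)%g x) \notin W by rewrite -permM -expgSr mini.
  by rewrite expgSr permM IHj 1?ltnW // permM (out_perm tW) // -permM -expgSr.
have stE : ((s * t) ^+ i.+1)%g x = t ((s ^+ i.+1)%g x).
  by rewrite [in LHS]expgSr permM agree // permM expgSr permM.
rewrite -stE; apply: first_returnE => // [|j ji].
  by rewrite stE perm_closed.
by rewrite agree // mini.
Qed.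

Lemma first_returnJ s t W : (forall x, (t x \in W) = (x \in W)) ->
  first_return (s ^ t) W = (first_return s W ^ t)%g.
Proof.
move=> tW; apply/permP=> x; rewrite -(permKV t x) permJ.
move: (t^-1%g x) => {}x.
have [xW|xW] := boolP (x \in W); last by rewrite !first_return_out ?tW.
have [i [-> siW mini]] := first_return_ex s xW.
have stX j : ((s ^ t) ^+ j)%g (t x) = t ((s ^+ j)%g x) by rewrite -conjXg permJ.
rewrite -stX; apply: first_returnE; rewrite ?stX ?tW //.
by move=> j ji; rewrite stX tW mini.
Qed.

Lemma mem_porbit1 s x : s x \in porbit s x.
Proof. by have := mem_porbit s 1 x; rewrite expg1. Qed.

Lemma first_returnX_porbit s W x i :
  x \in W -> (first_return s W ^+ i)%g x \in porbit s x :&: W.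
Proof.
move=> xW; elim: i => [|i]; first by rewrite expg0 perm1 inE porbit_id.
rewrite expgSr permM !inE first_return_stable => /andP[xi iW].
rewrite iW andbT; have [j [-> _ _]] := first_return_ex s iW.
move: xi; rewrite -!eq_porbit_mem => /eqP<-.
by rewrite eq_porbit_mem mem_porbit.
Qed.

Lemma porbit_first_return s W x : x \in W ->
  porbit (first_return s W) x = porbit s x :&: W.
Proof.
move=> xW; apply/setP=> y; apply/idP/idP=> [/porbitP[i ->]|].
  exact: first_returnX_porbit.
rewrite inE => /andP[/porbitP[i ->]].
elim/ltn_ind: i x xW => -[|i] IHi x xW; first by rewrite expg0 perm1 porbit_id.
have [j [frE jW minj]] := first_return_ex s xW; move=> iW.
have ji : j <= i by rewrite leqNgt; apply: contraL iW; apply: minj.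
have := IHi (i - j) (leq_subr _ _) _ jW.
rewrite -permM -expgD addSn addnC subnK // => /(_ iW).
suff -> : porbit (first_return s W) ((s ^+ j.+1)%g x) =
          porbit (first_return s W) x by [].
by rewrite -frE; apply/eqP; rewrite eq_porbit_mem mem_porbit1.
Qed.

Definition closed_cycles s A := [set f in porbits s | f \subset A].

(** A cycle meeting [W] leaves on [W] a cycle of the first-return map. Distinct cycles leave
    distinct traces because they are disjoint. *)
Lemma closed_cycles_first_return s W A :
  #|[set f in closed_cycles s A | f :&: W != set0]|
    <= #|closed_cycles (first_return s W) (A :&: W)|.
Proof.
have fE (f : {set T}) : f \in porbits s -> f :&: W != set0 ->
    exists2 x, x \in W & f = porbit s x.
  move=> /imsetP[z _ ->] /set0Pn[x /setIP[xz xW]]; exists x => //.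
  by apply/esym/eqP; rewrite eq_porbit_mem.
have inj : {in [set f in closed_cycles s A | f :&: W != set0] &,
    injective (fun f => f :&: W)}.
  move=> f1 f2; rewrite !inE => /andP[/andP[pf1 _] f1W] /andP[/andP[pf2 _] f2W].
  have [x xW f1E] := fE _ pf1 f1W; have /imsetP[z _ f2E] := pf2.
  move=> /setP/(_ x); rewrite f1E f2E !inE xW porbit_id !andbT /=.
  by rewrite -eq_porbit_mem => /esym/eqP->.
rewrite -(card_in_imset inj); apply/subset_leq_card/subsetP=> g /imsetP[f].
rewrite inE inE => /andP[/andP[pf fA] fW] ->.
have [x xW f1E] := fE _ pf fW.
rewrite inE setSI // andbT f1E -porbit_first_return //.
exact: imset_f.
Qed.

(** The only cycle that can disappear when [a] is cut out is the singleton of [a]. *)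
Lemma card_closed_cycles_D1 s A a : a \in A ->
  #|closed_cycles s A|
    <= (s a == a) + #|closed_cycles (first_return s [set~ a]) (A :\ a)|.
Proof.
move=> aA; rewrite setDE.
set D := [set f : {set T} | f :&: [set~ a] != set0].
have := closed_cycles_first_return s [set~ a] A.
rewrite setIdE -/D -(leq_add2l #|closed_cycles s A :\: D|) addnC cardsID.
move=> /leq_trans; apply; rewrite leq_add2r.
apply: (@leq_trans #|if s a == a then [set [set a]] else set0|); last first.
  by case: ifP; rewrite ?cards1 ?cards0.
apply/subset_leq_card/subsetP=> f; rewrite !inE negbK => /andP[/eqP fa].
move=> /andP[/imsetP[x _ fE] _].
have suba : f \subset [set a] by rewrite -setD_eq0 setDE fa.
have xa : x = a.
  by apply/set1P/(subsetP suba); rewrite fE porbit_id.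
have : s a \in f by rewrite fE xa mem_porbit1.
move=> /(subsetP suba); rewrite inE => sa; rewrite sa inE eqEsubset suba.
by rewrite sub1set fE xa porbit_id.
Qed.

(** The transposition makes [a] a fixed point and sends the predecessor of [a] straight to [s a]. *)
Lemma first_return_setC1 s a : first_return s [set~ a] = (s * tperm a (s a))%g.
Proof.
apply/permP=> x; rewrite permM.
have [->|xa] := eqVneq x a.
  by rewrite tpermR first_return_out // !inE eqxx.
have xW : x \in [set~ a] by rewrite !inE.
have [sxa|sxa] := eqVneq (s x) a.
  rewrite sxa tpermL (@first_returnE _ _ _ 1) //.
  - by rewrite expgS expg1 permM sxa.
  - rewrite expgS expg1 permM sxa !inE.
    by apply: contra_neq xa => sa; apply: (@perm_inj _ s); rewrite sxa sa.
  by move=> [|//] _; rewrite expg1 sxa !inE eqxx.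
rewrite tpermD 1?eq_sym // 1?(inj_eq perm_inj) //.
by rewrite (@first_returnE _ _ _ 0) // expg1 !inE.
Qed.

Lemma closed_cycles0 s : closed_cycles s set0 = set0.
Proof.
apply/setP=> f; rewrite !inE subset0; apply/negP=> /andP[/imsetP[x _ ->]].
by move=> /eqP/setP/(_ x); rewrite porbit_id inE.
Qed.

Lemma eq_in_porbits s t (f : {set T}) : f \in porbits s ->
  {in f, s =1 t} -> f \in porbits t.
Proof.
move=> /imsetP[x _ ->] st; suff -> : porbit s x = porbit t x by apply: imset_f.
have stX i : (s ^+ i)%g x = (t ^+ i)%g x.
  elim: i => [|i IHi]; first by rewrite !expg0.
  by rewrite !expgSr !permM -IHi st // mem_porbit.
by apply/setP=> y; apply/porbitP/porbitP=> -[i ->]; exists i.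
Qed.

End FirstReturn.

(** * Uniform cyclic permutations *)

Section CyclicPerm.
Variable T : finType.
Implicit Types (s t r : {perm T}) (W A B : {set T}) (x y a b : T).

Definition cyclic_on A : {set {perm T}} :=
  [set s : {perm T} | perm_on A s && [forall d in A, porbit s d == A]].

Lemma cyclic_onP A s :
  reflect (perm_on A s /\ {in A, forall x, porbit s x = A}) (s \in cyclic_on A).
Proof.
rewrite inE; apply: (iffP andP) => -[sA].
  by move=> /forallP h; split=> // x xA; apply/eqP; have /implyP := h x; apply.
move=> h; split=> //; apply/forallP=> x; apply/implyP=> xA.
by rewrite h.
Qed.

Lemma cyclic_on0 : cyclic_on set0 = [set 1%g].
Proof.
apply/setP=> s; rewrite in_set1; apply/cyclic_onP/eqP=> [[s0 _]|->].
  by apply: perm_on_id s0 _; rewrite cards0.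
by split=> [|x]; [exact: perm_on1 | rewrite inE].
Qed.

Lemma cyclic_on1 a : cyclic_on [set a] = [set 1%g].
Proof.
apply/setP=> s; rewrite in_set1; apply/cyclic_onP/eqP=> [[sa _]|->].
  by apply: perm_on_id sa _; rewrite cards1.
split=> [|_ /set1P->]; first exact: perm_on1.
apply/setP=> y; rewrite inE; apply/porbitP/eqP=> [[i ->]|->].
  by rewrite expg1n perm1.
by exists 0; rewrite perm1.
Qed.

Lemma cyclic_onJ A s t : (s ^ t \in cyclic_on (t @: A))%g = (s \in cyclic_on A).
Proof.
have porbitJ x : porbit (s ^ t)%g (t x) = t @: porbit s x.
  apply/setP=> y; apply/porbitP/imsetP => [[i ->]|[z /porbitP[i ->] ->]].
    by exists ((s ^+ i)%g x); rewrite ?mem_porbit // -conjXg permJ.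
  by exists i; rewrite -conjXg permJ.
apply/cyclic_onP/cyclic_onP=> -[sA h]; split.
- apply/subsetP=> x; rewrite inE => sx.
  have /(subsetP sA) : (t x) \in [pred y | (s ^ t)%g y != y].
    by rewrite inE permJ (inj_eq perm_inj).
  by move=> /imsetP[z zA /perm_inj->].
- move=> x xA; apply: (imset_inj (@perm_inj _ t)).
  by rewrite -porbitJ h // imset_f.
- apply/subsetP=> y; rewrite inE -[y](permKV t) permJ (inj_eq perm_inj) => sx.
  by rewrite imset_f //; apply: (subsetP sA); rewrite inE.
- by move=> _ /imsetP[x xA ->]; rewrite porbitJ h.
Qed.

Lemma card_cyclic_onJ A t : #|cyclic_on (t @: A)| = #|cyclic_on A|.
Proof.
rewrite -(card_imset (cyclic_on A) (@conjg_inj _ t)).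
apply: eq_card => s; rewrite -[s](conjgKV t) cyclic_onJ.
apply/idP/imsetP=> [sA|[r rA /conjg_inj-> //]].
by exists (s ^ t^-1)%g.
Qed.

Lemma first_return_setC1_l r a :
  first_return r [set~ a] = (tperm (r^-1 a) a * r)%g.
Proof.
by rewrite first_return_setC1 conjgCV tpermJ permK.
Qed.

Lemma tperm_first_return r a :
  (tperm a (r^-1 a) * first_return r [set~ a])%g = r.
Proof. by rewrite first_return_setC1_l mulgA (tpermC a) tperm2 mul1g. Qed.

Lemma cyclic_on_D1 A r a : a \in A -> 1 < #|A| -> r \in cyclic_on A ->
  r^-1%g a \in A :\ a /\ first_return r [set~ a] \in cyclic_on (A :\ a).
Proof.
move=> aA A1 /cyclic_onP[rA orb]; split.
  rewrite !inE; apply/andP; split; last first.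
    by rewrite -(perm_closed _ rA) permKV.
  apply/eqP=> ra; have {}ra : r a = a by rewrite -[in RHS](permKV r a) ra.
  have := A1; rewrite -(orb a aA) (_ : porbit r a = [set a]) ?cards1 //.
  apply/setP=> y; rewrite inE; apply/porbitP/eqP=> [[i ->]|->].
    by elim: i => [|i IHi]; rewrite ?perm1 // expgSr permM IHi.
  by exists 0; rewrite perm1.
apply/cyclic_onP; split; last first.
  move=> x; rewrite !inE => /andP[xa xA].
  by rewrite porbit_first_return ?inE // orb // setDE.
apply/subsetP=> x; rewrite inE => rx; rewrite !inE.
have xa : x != a.
  by apply: contra_neq rx => ->; rewrite first_return_out // !inE eqxx.
rewrite xa /=; apply: contraNT rx => xA; rewrite first_return_setC1 permM.
rewrite (out_perm rA xA) tpermD // 1?eq_sym //.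
by apply: contraNneq xA => ->; rewrite perm_closed.
Qed.

Lemma first_return_tpermM r a b : r a = a ->
  first_return (tperm a b * r) [set~ a] = r.
Proof.
move=> ra; have rVa : (r^-1 a)%g = a by rewrite -[in LHS]ra permK.
rewrite first_return_setC1_l invMg permM rVa tpermV tpermL.
by rewrite mulgA tpermC tperm2 mul1g.
Qed.

Lemma cyclic_on_tpermM A r a b : a \in A -> b \in A :\ a ->
  r \in cyclic_on (A :\ a) -> (tperm a b * r)%g \in cyclic_on A.
Proof.
move=> aA bA /cyclic_onP[rA orb]; have /setD1P[ba bA'] := bA.
have ra : r a = a by rewrite (out_perm rA) // !inE eqxx.
have orb' x : x \in A :\ a -> porbit (tperm a b * r) x :\ a = A :\ a.
  move=> xA; rewrite setDE -porbit_first_return ?first_return_tpermM ?orb //.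
  by move: xA; rewrite !inE => /andP[].
have ab x : x \in A :\ a -> porbit (tperm a b * r) x = A.
  move=> xA; have bx : b \in porbit (tperm a b * r) x.
    by have := bA; rewrite -(orb' x xA) !inE => /andP[].
  have ax : a \in porbit (tperm a b * r) x.
    move: bx; rewrite -!eq_porbit_mem => /eqP<-; rewrite eq_porbit_mem.
    by have := mem_porbit1 (tperm a b * r) b; rewrite permM tpermR ra.
  by rewrite -(setD1K ax) orb' // setD1K.
apply/cyclic_onP; split.
  apply/subsetP=> x; rewrite inE permM; apply: contraNT => xA.
  have xa : a != x by apply: contraNneq xA => <-.
  have xb : b != x by apply: contraNneq xA => <-.
  by rewrite tpermD // (out_perm rA) // !inE (negPf xA) andbF.
move=> x xA; have [->|xa] := eqVneq x a; last by rewrite ab // !inE xa.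
rewrite -[RHS](ab b bA); apply/eqP; rewrite eq_porbit_mem.
by have := mem_porbit1 (tperm a b * r) b; rewrite permM tpermR ra.
Qed.

(** A cyclic permutation of [A] amounts to a cyclic permutation of [A :\ a] together with the point
    [b] after which [a] is inserted. This is the mechanism for revealing a uniform rotation one dart
    at a time. *)
Lemma sum_cyclic_on_D1 (V : nmodType) (F : {perm T} -> V) A a :
  a \in A -> 1 < #|A| ->
  (\sum_(r in cyclic_on A) F r =
   \sum_(b in A :\ a) \sum_(r in cyclic_on (A :\ a)) F (tperm a b * r)%g)%R.
Proof.
move=> aA A1; rewrite pair_big /=.
rewrite (reindex_onto (fun q : T * {perm T} => (tperm a q.1 * q.2)%g)
  (fun r => ((r^-1)%g a, first_return r [set~ a]))) /=; last first.
  by move=> r _; rewrite tperm_first_return.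
apply: eq_bigl => -[b r] /=; apply/andP/andP=> [[rA /eqP eqr]|[bA rA]].
  by have := cyclic_on_D1 aA A1 rA; move: eqr => [-> ->].
rewrite cyclic_on_tpermM //; split=> //.
have ra : r a = a.
  by have /cyclic_onP[/out_perm->] := rA; rewrite // !inE eqxx.
rewrite first_return_tpermM // invMg permM tpermV.
have rVa : (r^-1 a)%g = a by rewrite -[in LHS]ra permK.
by rewrite rVa tpermL.
Qed.

Lemma card_cyclic_on_D1 A a : a \in A -> 1 < #|A| ->
  #|cyclic_on A| = #|A|.-1 * #|cyclic_on (A :\ a)|.
Proof.
move=> aA A1; rewrite -sum1_card (sum_cyclic_on_D1 _ aA A1) /=.
rewrite big_const iter_addr_0 sum1_card.
by rewrite (cardsD1 a A) aA add1n /= -mulr_natr mulnC natn.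
Qed.

Lemma card_cyclic_on_gt0 A : 0 < #|cyclic_on A|.
Proof.
elim: {A}#|A| {-2}A (erefl #|A|) => [|n IHn] A cA.
  by move/eqP: cA; rewrite cards_eq0 => /eqP->; rewrite cyclic_on0 cards1.
have [a aA] : exists a, a \in A by apply/set0Pn; rewrite -cards_eq0 cA.
have [n0|n0] := posnP n.
  have /eqP/cards1P[b ->] : #|A| = 1 by rewrite cA n0.
  by rewrite cyclic_on1 cards1.
have cD : #|A :\ a| = n by have := cardsD1 a A; rewrite aA cA => -[].
rewrite (card_cyclic_on_D1 aA) ?cA // muln_gt0 n0.
exact: IHn.
Qed.

End CyclicPerm.

(** * Cycles of a permutation times a random cyclic permutation *)

Section CycleBound.
Variable R : realFieldType.
Local Open Scope ring_scope.

(** This is (1 + H_(d-1)) / d. At d = 0 division by zero gives 0, so monotonicity in [d] holds only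
    for positive arguments. *)
Definition cycle_rate (d : nat) : R := (1 + \sum_(1 <= j < d) j%:R^-1) / d%:R.

Lemma mul_cycle_rate d : (0 < d)%N ->
  d%:R * cycle_rate d = 1 + \sum_(1 <= j < d) j%:R^-1.
Proof. by move=> d0; rewrite mulrC divfK // pnatr_eq0 -lt0n. Qed.

Lemma cycle_rate_ge0 d : 0 <= cycle_rate d.
Proof.
by rewrite divr_ge0 // addr_ge0 // sumr_ge0 // => j _; rewrite invr_ge0.
Qed.

Lemma mul_cycle_rateS d : (0 < d)%N ->
  d.+1%:R * cycle_rate d.+1 = d%:R * cycle_rate d + d%:R^-1.
Proof.
by move=> d0; rewrite !mul_cycle_rate // big_nat_recr //= addrA.
Qed.

Lemma cycle_rate_diff d : (0 < d)%N ->
  d.+1%:R * (cycle_rate d - cycle_rate d.+1) = cycle_rate d - d%:R^-1.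
Proof. by move=> d0; rewrite mulrBr mul_cycle_rateS // -natr1; ring. Qed.

Lemma cycle_rate_nincr d : (0 < d)%N -> cycle_rate d.+1 <= cycle_rate d.
Proof.
move=> d0; have dP : 0 < d%:R :> R by rewrite ltr0n.
rewrite -subr_ge0 -(pmulr_rge0 _ (ltr0Sn R d)) cycle_rate_diff // subr_ge0.
rewrite -[_^-1]mul1r ler_pdivrMr // mulrC mul_cycle_rate // lerDl sumr_ge0 // => j _.
by rewrite invr_ge0.
Qed.

(** The inequality behind the induction on revealed darts: 1 / d pays for a cycle closed now, and
    one of the [c] returning darts is used up. It is affine in [c], with equality at c = d + 1. *)
Lemma cycle_rateS_step d c : (0 < d)%N -> (0 < c <= d.+1)%N ->
  d%:R^-1 + c.-1%:R * cycle_rate d <= c%:R * cycle_rate d.+1.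
Proof.
move=> d0 /andP[c0 cd].
have : c%:R * (cycle_rate d - cycle_rate d.+1) <= cycle_rate d - d%:R^-1.
  by rewrite -cycle_rate_diff // ler_wpM2r ?ler_nat // subr_ge0 cycle_rate_nincr.
have -> : c%:R = c.-1%:R + 1 :> R by rewrite natr1 prednK.
by rewrite mulrBr !mulrDl !mul1r; lra.
Qed.

Lemma le_cycle_rate c d : (0 < c <= d)%N -> cycle_rate d <= cycle_rate c.
Proof.
move=> /andP[c0]; elim: d => [|d IHd]; first by case: c c0.
rewrite leq_eqVlt => /predU1P[->//|]; rewrite ltnS => cd.
apply: le_trans (IHd cd); apply: cycle_rate_nincr.
exact: leq_trans cd.
Qed.

Variable T : finType.
Implicit Types (s r : {perm T}) (A B : {set T}).

(* The permutation left on the other points once [a] is sent to [b]: the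
   composite with [tperm a b], with [a] cut out of its cycle. *)
Definition bypass s a b := first_return (s * tperm a b) [set~ a].

(** Cutting out [a] loses a cycle only if [a] is fixed by the whole product. As [r] fixes [a], this
    happens exactly when [s a = b]. *)
Lemma card_closed_cycles_bypass s A a b r : a \in A -> b \in A :\ a ->
    perm_on (A :\ a) r ->
  (#|closed_cycles (s * (tperm a b * r)) A|
    <= (s a == b) + #|closed_cycles (bypass s a b * r) (A :\ a)|)%N.
Proof.
move=> aA bA rA; have /setD1P[ba _] := bA.
have ra : r a = a by rewrite (out_perm rA) // !inE eqxx.
have rC : perm_on [set~ a] r.
  by apply: subset_trans rA _; rewrite setDE subsetIr.
apply: leq_trans (card_closed_cycles_D1 _ aA) _.
rewrite mulgA first_return_mulr // leq_add2r !permM.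
suff -> : (r (tperm a b (s a)) == a) = (s a == b) by [].
rewrite -[X in _ == X]ra (inj_eq perm_inj).
by rewrite -[X in _ == X](tpermR a b) (inj_eq perm_inj).
Qed.

Lemma bypass_eq s a b x : x != a -> b != a -> s x != a ->
  (s x = b -> s a = a) -> bypass s a b x = s x.
Proof.
move=> xa ba sxa sxb; rewrite /bypass first_return_setC1 !permM.
have [sxbE|sxb'] := eqVneq (s x) b.
  by rewrite sxb // sxbE tpermR !tpermL.
have txE : tperm a b (s x) = s x by rewrite tpermD // eq_sym.
rewrite txE tpermD //; first by rewrite eq_sym.
by rewrite -[X in _ != X]txE !(inj_eq perm_inj) eq_sym.
Qed.

Lemma bypass_in s A a b x : x != a -> a \in A -> b \in A :\ a ->
  bypass s a b x \in A -> s x \in A.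
Proof.
move=> xa aA /setD1P[ba bA]; apply: contraLR => sxA.
rewrite bypass_eq //; first by apply: contraNneq sxA => ->.
by move=> sxb; rewrite sxb bA in sxA.
Qed.

Lemma sum_closed_cycles_const (A : {set T}) (c : R) n :
    (forall r, r \in cyclic_on A -> (n r)%:R <= c) ->
  \sum_(r in cyclic_on A) (n r)%:R <= #|cyclic_on A|%:R * c.
Proof.
move=> le; apply: le_trans (ler_sum _ le) _.
by rewrite sumr_const mulr_natl.
Qed.

Lemma card_closed_cycles_set1 s a : (#|closed_cycles s [set a]| <= (s a == a))%N.
Proof.
apply: leq_trans (card_closed_cycles_D1 _ (set11 a)) _.
by rewrite setDv closed_cycles0 cards0 addn0.
Qed.

(** Induction on the size of [A], revealing the rotation at one point per step. The set [B] contains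
    the points moved by [s] but may be larger: a bypass can create new fixed points, and keeping
    them in [B] keeps the count in [cycle_rate] under control. *)
Lemma sum_closed_cycles s A B : B \subset A ->
    (forall x, x \in A :\: B -> s x = x) ->
  \sum_(r in cyclic_on A) #|closed_cycles (s * r) A|%:R <= #|cyclic_on A|%:R *
    (((A != set0) && (B == set0))%:R
      + #|[set x in B | s x \in A]|%:R * cycle_rate #|B|).
Proof.
elim: {A}#|A| {-2}A (erefl #|A|) s B => [|n IHn] A cA s B BA fixed.
  move/eqP: cA; rewrite cards_eq0 => /eqP ->.
  rewrite big1 => [|r _]; last by rewrite closed_cycles0 cards0.
  by rewrite mulr_ge0 // addr_ge0 // mulr_ge0 // cycle_rate_ge0.
have A0 : A != set0 by rewrite -cards_eq0 cA.
have [n0|n0] := posnP n.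
  have /eqP/cards1P[a Aa] : #|A| = 1%N by rewrite cA n0.
  apply: sum_closed_cycles_const => r; rewrite Aa cyclic_on1 => /set1P->.
  rewrite mulg1; apply: (@le_trans _ _ (s a == a)%:R).
    by rewrite ler_nat card_closed_cycles_set1.
  have [B0|[x xB]] := set_0Vmem B.
    rewrite B0 eqxx -Aa A0 /=; apply: ler_wpDr.
      by rewrite mulr_ge0 // cycle_rate_ge0.
    by case: eqP.
  have {x xB}BE : B = [set a].
    apply/eqP; rewrite eqEsubset -{1}Aa BA /= sub1set.
    by have := subsetP BA _ xB; rewrite Aa inE => /eqP <-.
  apply: ler_wpDl => //; rewrite BE cards1 /cycle_rate big_geq // addr0 divr1 mulr1.
  rewrite ler_nat; case: eqP => // sa; rewrite card_gt0; apply/set0Pn.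
  by exists a; rewrite !inE sa eqxx.
have A1 : (1 < #|A|)%N by rewrite cA.
have cD a : a \in A -> #|A :\ a| = n.
  by move=> aA; have := cardsD1 a A; rewrite aA cA => -[].
have D0 a : a \in A -> A :\ a != set0.
  by move=> aA; rewrite -cards_eq0 cD // -lt0n.
(* Among the [n] equally likely predecessors [b] of [a], at most one equals [s a], so a cycle is
   closed at [a] for at most one choice. *)
have step a (c : R) : a \in A ->
    (forall b, b \in A :\ a ->
      \sum_(r in cyclic_on (A :\ a))
        #|closed_cycles (bypass s a b * r) (A :\ a)|%:R
        <= #|cyclic_on (A :\ a)|%:R * c) ->
    \sum_(r in cyclic_on A) #|closed_cycles (s * r) A|%:R <=
    #|cyclic_on (A :\ a)|%:R * ((s a \in A :\ a)%:R + n%:R * c).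
  move=> aA le_c; rewrite (sum_cyclic_on_D1 _ aA A1).
  apply: (@le_trans _ _ (\sum_(b in A :\ a) #|cyclic_on (A :\ a)|%:R *
      ((s a == b)%:R + c))).
    apply: ler_sum => b bA; rewrite mulrDr; apply: le_trans (lerD (lexx _) (le_c b bA)).
    rewrite mulr_natl -sumr_const -big_split /=; apply: ler_sum => r /cyclic_onP[rA _].
    by rewrite -natrD ler_nat card_closed_cycles_bypass.
  rewrite -mulr_sumr ler_wpM2l // big_split /= sumr_const (cD _ aA) mulr_natl lerD2r.
  have [saA|saA] := boolP (s a \in A :\ a).
    rewrite (bigD1 (s a)) //= eqxx big1 ?addr0 // => b /andP[_ /negPf].
    by rewrite eq_sym => ->.
  rewrite big1 // => b bA; case: eqP => // sab.
  by rewrite sab bA in saA.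
have cyc a : a \in A ->
    #|cyclic_on A|%:R = n%:R * #|cyclic_on (A :\ a)|%:R :> R.
  by move=> aA; rewrite (card_cyclic_on_D1 aA A1) cA /= natrM.
(* A point [a] outside [B] is fixed by [s], so no [b] in [A :\ a] equals [s a]. Revealing it closes
   no cycle and leaves [s] unchanged on the rest of [A]. *)
have [AB0|[a aAB]] := set_0Vmem (A :\: B); last first.
  have [aA aB] := setDP aAB; have sa := fixed a aAB.
  have byp b x : b \in A :\ a -> x \in A :\ a -> bypass s a b x = s x.
    move=> /setD1P[ba _] /setD1P[xa _]; rewrite bypass_eq //.
    by apply: contra_neq xa => sx; apply: (@perm_inj _ s); rewrite sx sa.
  have BA' : B \subset A :\ a.
    by rewrite subsetD1 BA aB.
  set c := _ + _.
  apply: le_trans (step a c aA _) _ => [b bA|]; last first.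
    by rewrite sa !inE eqxx /= add0r (cyc a aA) mulrA (mulrC n%:R).
  apply: le_trans (IHn _ (cD a aA) _ B BA' _) _ => [x /setDP[xA xB]|].
    rewrite byp // fixed // inE xB; by case/setD1P: xA.
  rewrite ler_wpM2l // lerD //.
    by rewrite ler_nat A0 (D0 a aA).
  rewrite ler_wpM2r ?cycle_rate_ge0 // ler_nat; apply/subset_leq_card/subsetP=> x.
  rewrite !inE => /andP[xB]; rewrite xB (byp b x bA (subsetP BA' x xB)).
  by case/andP.
have {BA fixed AB0} -> : B = A.
  by apply/eqP; rewrite eqEsubset BA -setD_eq0 AB0 eqxx.
rewrite (negPf A0) andbF add0r.
(* A cycle inside [A] needs a point that [s] sends into [A], because [r] preserves [A]. If there is
   such a point, it is the one to reveal. *)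
have [ret0|[a]] := set_0Vmem [set x in A | s x \in A].
  rewrite ret0 cards0 mul0r mulr0 big1 // => r /cyclic_onP[rA _].
  apply/eqP; rewrite pnatr_eq0 cards_eq0; apply/eqP/setP=> f; rewrite !inE.
  apply/negP=> /andP[/imsetP[x _ ->] /subsetP fA].
  have /setP/(_ x) := ret0; rewrite !inE fA ?porbit_id //=.
  by rewrite -(perm_closed _ rA) -permM fA // mem_porbit1.
rewrite inE => /andP[aA saA]; set m := #|[set x in A | s x \in A]|.
have m0 : (0 < m)%N by rewrite card_gt0; apply/set0Pn; exists a; rewrite inE aA.
have mA : (m <= n.+1)%N.
  by rewrite -cA; apply/subset_leq_card/subsetP=> x; rewrite inE => /andP[].
(* Here [n] is the size of [A :\ a]. By [bypass_in] no new returning point appears, and [a] itself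
   is gone, so at most m - 1 remain. *)
set c := m.-1%:R * cycle_rate n.
apply: le_trans (step a c aA _) _ => [b bA|]; last first.
  have nP : 0 < n%:R :> R by rewrite ltr0n.
  rewrite (cyc a aA) cA (mulrC n%:R #|_|%:R) -mulrA ler_wpM2l //.
  rewrite -ler_pdivrMl // mulrDr mulKf ?gt_eqF //.
  apply: le_trans (cycle_rateS_step n0 _); last by rewrite m0 mA.
  by rewrite lerD2r ler_piMr ?invr_ge0 ?ler0n // lern1 leq_b1.
apply: le_trans (IHn _ (cD a aA) _ _ (subxx _) _) _ => [x|]; first by rewrite setDv inE.
rewrite (negPf (D0 a aA)) andbF add0r ler_wpM2l // (cD a aA) /c.
rewrite ler_wpM2r ?cycle_rate_ge0 // ler_nat -ltnS prednK // /m.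
rewrite (cardsD1 a [set x in A | s x \in A]) inE aA saA add1n ltnS.
apply/subset_leq_card/subsetP=> x; rewrite !inE => /andP[/andP[xa xA]].
by move=> /andP[_ bx]; rewrite xa xA (bypass_in xa aA bA bx).
Qed.

End CycleBound.

(** * Charging faces to their largest vertex *)

Section CardSum.
Variables (I T : finType).
Implicit Types (A : {set T}) (B : I -> {set T}).

Lemma card_sum_mem (A : {set T}) : #|A| = \sum_x (x \in A).
Proof. by rewrite -sum1_card big_mkcond; apply: eq_bigr => x _; case: ifP. Qed.

Lemma card_le_sum A B : (forall x, x \in A -> exists i, x \in B i) ->
  #|A| <= \sum_i #|B i|.
Proof.
move=> AB; rewrite card_sum_mem; under [leqRHS]eq_bigr do rewrite card_sum_mem.
rewrite exchange_big leq_sum //= => x _.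
have [/AB[i xi]|//] := boolP (x \in A).
by rewrite (bigD1 i) //= xi.
Qed.

Lemma sum_card_le (P : pred I) A B : (forall i, P i -> B i \subset A) ->
    (forall x i j, P i -> P j -> x \in B i -> x \in B j -> i = j) ->
  \sum_(i | P i) #|B i| <= #|A|.
Proof.
move=> BA disj; rewrite card_sum_mem; under eq_bigr do rewrite card_sum_mem.
rewrite exchange_big leq_sum //= => x _.
have [/existsP[i /andP[Pi xi]]|no] := boolP [exists i, P i && (x \in B i)].
  rewrite (bigD1 i) //= big1 => [|j /andP[Pj ji]].
    by rewrite addn0 xi (subsetP (BA i Pi)).
  by apply/eqP; rewrite eqb0; apply: contra_neqN ji => xj; apply: (disj x).
rewrite big1 // => i Pi; apply/eqP; rewrite eqb0; apply: contraNN no => xi.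
by apply/existsP; exists i; rewrite Pi.
Qed.

End CardSum.

Section Faces.
Variable n : nat.
Implicit Types (G : graph n) (d x y : dart n) (u v w : 'I_n) (e : edge n).
Implicit Types (r s : {ffun 'I_n -> {perm dart n}}).

Lemma opposite_ends v e : v \in ends e ->
  opposite v e != v /\ ends e = [set v; opposite v e].
Proof.
move=> ve.
have [w wv ew] : exists2 w, w != v & ends e = [set v; w].
  have /cards2P[x [y [xy exy]]] := valP e; rewrite /= in exy.
  move: ve; rewrite exy !inE => /orP[]/eqP->.
    by exists y; first rewrite eq_sym.
  by exists x; last rewrite setUC.
suff -> : opposite v e = w by [].
rewrite /opposite; case: pickP => [z|/(_ w)] /=.
  by rewrite ew !inE => /andP[/negPf->] /= /eqP.
by rewrite ew !inE wv eqxx orbT.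
Qed.

Lemma oppositeE v w e : v != w -> ends e = [set v; w] -> opposite v e = w.
Proof.
move=> vw ew; have ve : v \in ends e by rewrite ew !inE eqxx.
have [opv oe] := opposite_ends ve.
have : opposite v e \in ends e by rewrite oe !inE eqxx orbT.
by rewrite ew !inE (negPf opv) => /eqP.
Qed.

Lemma flipE G d : d \in darts G -> flip G d = (opposite d.1 d.2, d.2).
Proof. by rewrite permE /flip_fun => ->. Qed.

Lemma flip_out G d : d \notin darts G -> flip G d = d.
Proof. by rewrite permE /flip_fun => /negPf->. Qed.

Lemma flipK G : involutive (flip G).
Proof. by move=> d; rewrite !permE flip_funK. Qed.

Lemma flip_darts G d : (flip G d \in darts G) = (d \in darts G).
Proof.
have sub d' : d' \in darts G -> flip G d' \in darts G.
  move=> dG; rewrite flipE //; move: dG; rewrite !inE /= => /andP[-> de].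
  by have [_ ->] := opposite_ends de; rewrite !inE eqxx orbT.
by apply/idP/idP=> [/sub|/sub//]; rewrite flipK.
Qed.

Lemma flip_eq G d d' : d \in darts G -> d' \in darts G -> d.2 = d'.2 ->
  d.1 != d'.1 -> flip G d = d'.
Proof.
case: d d' => [v e] [w e'] /= dG d'G ee' vw; rewrite -{e'}ee' in d'G *.
move: (dG) d'G; rewrite flipE // !inE /= => /andP[_ ve] /andP[_ we].
have [_ E] := opposite_ends ve; congr pair.
by move: we; rewrite E !inE eq_sym (negPf vw) => /eqP.
Qed.

Lemma flip_neq G d : d \in darts G -> (flip G d).1 != d.1.
Proof.
move=> dG; rewrite flipE //; move: dG; rewrite inE => /andP[_ /opposite_ends[]] //.
Qed.

Definition supported G r := forall v, perm_on (darts_at G v) (r v).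

Lemma darts_atP G v d : reflect (d \in darts G /\ d.1 = v) (d \in darts_at G v).
Proof.
by rewrite [d \in darts_at _ _]in_set; apply: (iffP andP) => -[dG /eqP].
Qed.

Lemma rotationE G r d : supported G r -> rotation r d = r d.1 d.
Proof.
move=> supp.
have out v d' : d'.1 != v -> r v d' = d'.
  move=> dv; rewrite (out_perm (supp v)) //.
  by apply/negP=> /darts_atP[_ /eqP]; rewrite (negPf dv).
have sub v d' : d'.1 = v -> (r v d').1 = v.
  move=> d'v; have [d'G|d'G] := boolP (d' \in darts_at G v).
    by move: d'G; rewrite -(perm_closed _ (supp v)) => /darts_atP[].
  by rewrite (out_perm (supp v)).
suff : forall l, uniq l ->
    (\prod_(v <- l) r v)%g d = if d.1 \in l then r d.1 d else d.
  move=> /(_ _ (index_enum_uniq _)); rewrite /rotation => ->.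
  by rewrite mem_index_enum.
elim=> [|v l IHl] /=; first by move=> _; rewrite big_nil perm1.
move=> /andP[vl /IHl]; rewrite big_cons permM inE.
have [dv|dv] := eqVneq d.1 v; last by rewrite (out v d dv).
move=> _ /=; rewrite dv; have := sub v d dv.
move: {IHl dv}(r v d) => d' d'v; elim: l vl => [|w l IHl].
  by rewrite big_nil perm1.
rewrite inE negb_or => /andP[vw vl]; rewrite big_cons permM out ?d'v //.
exact: IHl.
Qed.

Definition faces_topped_at G r (k : 'I_n) : {set {set dart n}} :=
  [set f in porbits (flip G * rotation r)%g |
    (f \subset [set d in darts G | d.1 <= k])
      && [exists d in f, d.1 == k]].

Lemma connect_adjacent_equiv G :
  {in [set: 'I_n] & &, equivalence_rel (connect (adjacent G))}.
Proof.
have symG : connect_sym (adjacent G).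
  apply: sym_connect_sym => v w; rewrite /adjacent /=.
  by apply: eq_existsb => e; rewrite setUC.
move=> u v w _ _ _; split=> [|uv]; first exact: connect0.
exact: same_connect.
Qed.

Lemma componentsP G : partition (components G) [set: 'I_n].
Proof. exact/equivalence_partitionP/connect_adjacent_equiv. Qed.

(** Subtracting the number of components cancels the bound 1 allowed to each of them in [cf_le]. If
    the graph has an edge, the component [C0] of one of its ends needs no such allowance, and this
    absorbs the final + 1; for the empty graph the + 1 stays. *)
Lemma faces_le G r :
  (faces G r <= (G == set0)%:Z + (\sum_k #|faces_topped_at G r k|)%N%:Z)%R.
Proof.
pose allf := [set f in porbits (flip G * rotation r)%g | f \subset darts G].
have [_ triv _] := and3P (componentsP G).
have same_comp v C : C \in components G -> v \in C -> C = pblock (components G) v.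
  by move=> CG vC; rewrite (def_pblock triv CG vC).
have allf_le : #|allf| <= \sum_k #|faces_topped_at G r k|.
  apply: card_le_sum => f; rewrite inE => /andP[fp /subsetP fG].
  have [x xf] : exists x, x \in f.
    by have /imsetP[x _ ->] := fp; exists x; apply: porbit_id.
  have [d df dmax] := @arg_maxnP _ x (fun d => d \in f) (fun d => val d.1) xf.
  exists d.1; rewrite !inE fp /=; apply/andP; split.
    by apply/subsetP=> y yf; rewrite in_set fG //=; apply: dmax.
  by apply/existsP; exists d; rewrite df eqxx.
have fc_le : \sum_(C in components G) #|face_cycles G r C| <= #|allf|.
  apply: sum_card_le => [C _|f C D CG DG].
    apply/subsetP=> f; rewrite !inE => /andP[-> /subset_trans]; apply.
    by apply/subsetP=> d; rewrite in_set => /andP[].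
  rewrite !inE => /andP[/imsetP[x _ ->] /subsetP fC] /andP[_ /subsetP fD].
  have := fC x (porbit_id _ _); have := fD x (porbit_id _ _).
  rewrite !in_set => /andP[_ xD] /andP[_ xC].
  by rewrite (same_comp x.1 C) // (same_comp x.1 D).
have cf_le C : component_faces G r C <= 1 + #|face_cycles G r C|.
  by rewrite /component_faces; case: ifP.
suff : \sum_(C in components G) component_faces G r C + 1
    <= #|components G| + (G == set0) + \sum_(C in components G) #|face_cycles G r C|.
  rewrite /faces; lia.
have [_|] := eqVneq G set0.
  rewrite -addnA addnCA -sum1_card -big_split /= addnC leq_add2l.
  by apply: leq_sum => C _; apply: cf_le.
case/set0Pn=> e eG.
have [v ve] : exists v, v \in ends e.
  have /cards2P[x [y [_ E]]] := valP e; rewrite /= in E.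
  by exists x; rewrite E !inE eqxx.
have vc : v \in cover (components G) by rewrite (cover_partition (componentsP G)) inE.
have CG := pblock_mem vc; set C0 := pblock _ v in CG.
have cf0 : component_faces G r C0 = #|face_cycles G r C0|.
  rewrite /component_faces ifN //; apply/set0Pn; exists (v, e).
  by rewrite !inE /= eG ve /= mem_pblock.
have : \sum_(C in components G | C != C0) component_faces G r C
    <= \sum_(C in components G | C != C0) (1 + #|face_cycles G r C|).
  by apply: leq_sum => C _; apply: cf_le.
have D1 (F : {set 'I_n} -> nat) : \sum_(C in components G) F C
    = F C0 + \sum_(C in components G | C != C0) F C by rewrite (bigD1 C0).
rewrite big_split /= -[#|components G|]sum1_card !D1 cf0 => le_rest.
by rewrite addn0 (addnC _ 1) -[leqRHS]addnA leq_add2l addnCA leq_add2l.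
Qed.

End Faces.

(** * Detours through the vertices below [k] *)

Section Returns.
Variable n : nat.
Implicit Types (G : graph n) (d x y : dart n) (k u v w : 'I_n) (e : edge n).
Implicit Types (r s : {ffun 'I_n -> {perm dart n}}).

Definition upper_darts k : {set dart n} := [set d : dart n | k <= d.1].

(** With the identity at [k] and above, a face walk arrives there without turning. The rotation at
    [k] is put back as a separate right factor. *)
Definition restrict_below k r : {ffun 'I_n -> {perm dart n}} :=
  [ffun v : 'I_n => if v < k then r v else 1%g].

(* Follows a face through vertices below [k] until it is back at a vertex
   at least [k]. *)
Definition detour G k s : {perm dart n} :=
  first_return (flip G * rotation s)%g (upper_darts k).

Definition moved_darts G k s : {set dart n} :=
  [set x in darts_at G k | detour G k s x != x].

Definition returning_darts G k s : {set dart n} :=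
  [set x in moved_darts G k s | detour G k s x \in darts_at G k].

Definition supported_below G k s :=
  supported G s /\ forall v, k <= v -> s v = 1%g.

Lemma supported_restrict G k r :
  supported G r -> supported_below G k (restrict_below k r).
Proof.
move=> supp; split=> v; last by rewrite ffunE ltnNge => ->.
by rewrite ffunE; case: ifP => _; [exact: supp | exact: perm_on1].
Qed.

Lemma porbits_step (s : {perm dart n}) (f : {set dart n}) x :
  f \in porbits s -> x \in f -> s x \in f.
Proof.
move=> /imsetP[z _ ->] xz.
have /eqP <- : porbit s x == porbit s z by rewrite eq_porbit_mem.
exact: mem_porbit1.
Qed.

(** A face with largest vertex [k] uses no rotation above [k], so it is also a cycle of the walk
    built from the rotations below [k] followed by [r k]. Its trace on the darts at [k] is then a
    cycle of the first-return map. *)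
Lemma card_faces_topped_at G k r : supported G r ->
  #|faces_topped_at G r k|
    <= #|closed_cycles (detour G k (restrict_below k r) * r k) (darts_at G k)|.
Proof.
move=> supp; have [supp' _] := supported_restrict k supp.
set A := [set d in darts G | d.1 <= k].
have AW : A :&: upper_darts k = darts_at G k.
  apply/setP=> d; rewrite in_setI !in_set -andbA; congr (_ && _).
  by rewrite -eqn_leq.
have rW : perm_on (upper_darts k) (r k).
  apply: subset_trans (supp k) _; apply/subsetP=> d /darts_atP[_ dk].
  by rewrite in_set dk.
rewrite -first_return_mulr // -AW.
apply: leq_trans (closed_cycles_first_return _ _ _).
apply/subset_leq_card/subsetP=> f; rewrite in_set => /and3P[fp fA /existsP[d]].
move=> /andP[df /eqP dk]; rewrite in_set in_set fA andbT; apply/andP; split; last first.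
  by apply/set0Pn; exists d; rewrite in_setI df in_set dk leqnn.
apply: (eq_in_porbits fp) => x xf.
have := subsetP fA _ (porbits_step fp xf); have := subsetP fA _ xf.
rewrite !in_set => /andP[xG _]; rewrite !permM (rotationE _ supp) (rotationE _ supp').
have fxG : flip G x \in darts_at G (flip G x).1.
  by rewrite in_set flip_darts eqxx andbT in_set.
set w := (flip G x).1 in fxG *.
have := fxG; rewrite -(perm_closed _ (supp w)) => /darts_atP[_ rw].
rewrite rw => /andP[_]; rewrite ffunE; case: ltngtP => // [wk _|/val_inj wk _].
  rewrite (out_perm (supp k)) //; apply/darts_atP => -[_].
  by rewrite rw => wk'; rewrite wk' ltnn in wk.
by rewrite perm1 wk.
Qed.

Lemma detour_up G k s x : supported_below G k s -> x \in darts G ->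
  k <= x.1 -> k <= (flip G x).1 -> detour G k s x = flip G x.
Proof.
move=> [supp s1] xG kx kfx.
have E : (flip G * rotation s)%g x = flip G x.
  by rewrite permM (rotationE _ supp) s1 // perm1.
by rewrite /detour (@first_returnE _ _ _ _ 0) ?expg1 ?E ?in_set.
Qed.

Lemma moved_up G k s x : supported_below G k s -> x \in darts_at G k ->
  k <= opposite k x.2 -> x \in moved_darts G k s.
Proof.
move=> supp xk up; rewrite in_set xk /=; have [xG x1] := darts_atP _ _ _ xk.
have fx := flipE xG.
have -> : detour G k s x = flip G x by rewrite detour_up ?x1 // fx x1.
by apply: contra_neq (flip_neq xG) => ->.
Qed.

(** The detour simply swaps the two darts of an edge between [k] and a higher vertex, so neither a
    departure from [k] nor an arrival at [k] along such an edge is part of a return to [k]. *)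
Lemma returning_low G k s x : supported_below G k s -> x \in darts_at G k ->
    detour G k s x \in darts_at G k ->
  opposite k x.2 < k /\ opposite k (detour G k s x).2 < k.
Proof.
move=> supp xk yk.
have low z z' : z \in darts_at G k -> z' \in darts_at G k -> k <= opposite k z.2 ->
    detour G k s z != z' /\ detour G k s z' != z.
  move=> zk z'k up; have [zG z1] := darts_atP _ _ _ zk.
  have [z'G z'1] := darts_atP _ _ _ z'k; have fz := flipE zG.
  have dz : detour G k s z = flip G z by rewrite detour_up ?z1 // fz z1.
  have fzk : (flip G z).1 != k by rewrite -z1 flip_neq.
  split; first by rewrite dz; apply: contraNneq fzk => ->; rewrite z'1.
  have dfz : detour G k s (flip G z) = z.
    by rewrite detour_up ?flipK ?flip_darts ?z1 // fz z1.
  rewrite -[X in _ != X]dfz (inj_eq perm_inj).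
  by apply: contraNneq fzk => <-; rewrite z'1.
split; rewrite ltnNge; apply/negP=> up.
  by have [/eqP] := low _ _ xk yk up.
by have [_ /eqP] := low _ _ yk xk up.
Qed.

End Returns.

(** * Exchanging two edges *)

Section Relabel.
Variables (n : nat) (k : 'I_n) (phi : {perm dart n}) (eps : {perm edge n}).
Implicit Types (G : graph n) (d x y : dart n) (u v w : 'I_n) (e : edge n).
Implicit Types (s : {ffun 'I_n -> {perm dart n}}).

Hypothesis phiK : involutive phi.
Hypothesis epsK : involutive eps.
Hypothesis phi_incident : forall d, d.1 \in ends d.2 ->
  (phi d).1 \in ends (phi d).2 /\ (phi d).2 = eps d.2.
Hypothesis phi_upper : forall d, (k <= (phi d).1) = (k <= d.1).
Hypothesis phi_lower : forall d, d.1 < k -> (phi d).1 = d.1.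

Definition relabel_graph G : graph n := eps @: G.
Definition relabel_rot s : {ffun 'I_n -> {perm dart n}} :=
  [ffun v => (s v ^ phi)%g].

Lemma relabel_graphK : involutive relabel_graph.
Proof.
by move=> G; rewrite /relabel_graph -imset_comp (eq_imset _ epsK) imset_id.
Qed.

Lemma relabel_rotK : involutive relabel_rot.
Proof.
have phi2 : (phi * phi)%g = 1%g by apply/permP=> d; rewrite permM perm1 phiK.
by move=> s; apply/ffunP=> v; rewrite !ffunE -conjgM phi2 conjg1.
Qed.

Lemma relabel_darts G d : (phi d \in darts (relabel_graph G)) = (d \in darts G).
Proof.
rewrite !inE; apply/andP/andP => -[eG /phi_incident[dinc E]].
  rewrite phiK in dinc E; split=> //; move: eG; rewrite E.
  by case/imsetP=> e eG ->; rewrite epsK.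
by split=> //; rewrite E imset_f.
Qed.

Lemma relabel_flip G : flip (relabel_graph G) = (flip G ^ phi)%g.
Proof.
apply/permP=> d; rewrite -(phiK d) permJ; move: (phi d) => {}d.
have [dG|dG] := boolP (d \in darts G); last first.
  by rewrite !flip_out ?relabel_darts.
have fG := dG; rewrite -flip_darts in fG.
have E x : x \in darts G -> (phi x).2 = eps x.2.
  by rewrite inE => /andP[_ /phi_incident[]].
have E2 : (phi d).2 = (phi (flip G d)).2 by rewrite !E // flipE.
apply: flip_eq => //; rewrite ?relabel_darts //.
apply: contra_neq (flip_neq dG) => E1.
suff /perm_inj <- : phi d = phi (flip G d) by [].
by rewrite [LHS]surjective_pairing E1 E2 -surjective_pairing.
Qed.

Lemma relabel_rotation s : rotation (relabel_rot s) = (rotation s ^ phi)%g.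
Proof.
rewrite /rotation (big_morph (fun t : {perm dart n} => t ^ phi)%g
  (fun a b => conjMg a b phi) (conj1g phi)).
by apply: eq_bigr => v _; rewrite ffunE.
Qed.

(** Flips, rotations and the upper set are all carried along by [phi]. It need not come from a
    permutation of the vertices, since rotations at [k] and above do not enter the detour. *)
Lemma relabel_detour G s :
  detour (relabel_graph G) k (relabel_rot s) = (detour G k s ^ phi)%g.
Proof.
rewrite /detour relabel_flip relabel_rotation -conjMg first_returnJ //.
by move=> d; rewrite !in_set phi_upper.
Qed.

Lemma relabel_darts_at G v : v < k ->
  darts_at (relabel_graph G) v = phi @: darts_at G v.
Proof.
move=> vk; apply/setP=> d; rewrite -[d]phiK mem_imset; last exact: perm_inj.
move: (phi d) => {}d; apply/darts_atP/darts_atP; rewrite relabel_darts.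
  move=> [dG dv]; split=> //; rewrite -dv phi_lower // ltnNge -phi_upper -ltnNge.
  by rewrite dv.
by move=> [dG dv]; split; rewrite // phi_lower dv.
Qed.

Lemma relabel_rotations_at G s v : v < k ->
  (relabel_rot s v \in rotations_at (relabel_graph G) v)
    = (s v \in rotations_at G v).
Proof.
move=> vk; rewrite ffunE.
have E H : rotations_at H v = cyclic_on (darts_at H v) by [].
by rewrite !E relabel_darts_at // cyclic_onJ.
Qed.

Lemma relabel_card_rotations_at G v : v < k ->
  #|rotations_at (relabel_graph G) v| = #|rotations_at G v|.
Proof.
move=> vk; have E H : rotations_at H v = cyclic_on (darts_at H v) by [].
by rewrite !E relabel_darts_at // card_cyclic_onJ.
Qed.

End Relabel.

(** * Probability weights and their invariance *)

Section Weights.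
Variables (R : realFieldType) (n : nat).
Implicit Types (G : graph n) (k v w : 'I_n).
Implicit Types (r s : {ffun 'I_n -> {perm dart n}}).
Local Open Scope ring_scope.

Definition rot_mass G v (t : {perm dart n}) : R :=
  (t \in rotations_at G v)%:R / #|rotations_at G v|%:R.

(** The law of [restrict_below k r] for a random [r]: from [k] on it is a point mass at the
    identity, which every relabelling preserves. *)
Definition below_mass k G s : R :=
  \prod_(v : 'I_n) (if (v < k)%N then rot_mass G v (s v) else (s v == 1%g)%:R).

Lemma rot_mass_ge0 G v t : 0 <= rot_mass G v t.
Proof. by rewrite divr_ge0 ?ler0n. Qed.

Lemma below_mass_ge0 k G s : 0 <= below_mass k G s.
Proof. by apply: prodr_ge0 => v _; case: ifP; rewrite ?rot_mass_ge0. Qed.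

Lemma below_mass_supported k G s : below_mass k G s != 0 -> supported_below G k s.
Proof.
move=> /prodf_neq0 nz; split=> v; last first.
  have := nz v isT; rewrite ltnNge => + kv; rewrite kv /=.
  by case: (s v =P 1%g) => // _; rewrite eqxx.
have := nz v isT; case: ifP => _; last first.
  by case: (s v =P 1%g) => [->|_]; rewrite ?eqxx // perm_on1.
rewrite /rot_mass; case: (boolP (_ \in _)) => [|_]; last by rewrite mul0r eqxx.
by rewrite inE => /andP[].
Qed.

End Weights.

Lemma below_mass_relabel (R : realFieldType) n (k : 'I_n)
    (phi : {perm dart n}) (eps : {perm edge n}) G s :
    involutive phi -> involutive eps ->
    (forall d : dart n, d.1 \in ends d.2 ->
       (phi d).1 \in ends (phi d).2 /\ (phi d).2 = eps d.2) ->
    (forall d : dart n, (k <= (phi d).1) = (k <= d.1)) ->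
    (forall d : dart n, d.1 < k -> (phi d).1 = d.1) ->
  below_mass R k (relabel_graph eps G) (relabel_rot phi s) = below_mass R k G s.
Proof.
move=> phiK epsK inc up low; apply: eq_bigr => v _; case: ifP => vk.
  rewrite /rot_mass (relabel_rotations_at phiK epsK inc up low) //.
  by rewrite (relabel_card_rotations_at phiK epsK inc up low).
by rewrite ffunE conjg_eq1.
Qed.

Section Gnp.
Variables (R : realType) (n : nat) (p : R).
Implicit Types (G : graph n).
Local Open Scope ring_scope.

Lemma gnp_mass_ge0 G : 0 <= p -> p <= 1 -> 0 <= gnp_mass p G.
Proof. by move=> p0 p1; apply: prodr_ge0 => e _; case: ifP; rewrite ?subr_ge0. Qed.

Lemma gnp_mass_relabel (eps : {perm edge n}) G :
  gnp_mass p (relabel_graph eps G) = gnp_mass p G.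
Proof.
rewrite /gnp_mass (reindex_inj (@perm_inj _ eps)); apply: eq_bigr => e _.
by rewrite mem_imset //; apply: perm_inj.
Qed.

End Gnp.

Section Swap.
Variables (n : nat) (k u w : 'I_n) (e e' : edge n).
Hypotheses (uk : u < k) (kw : k <= w).
Hypotheses (eE : ends e = [set u; k]) (e'E : ends e' = [set u; w]).
Implicit Types (G : graph n) (d x y : dart n).
Implicit Types (s : {ffun 'I_n -> {perm dart n}}).

Definition swap_edges : {perm edge n} := tperm e e'.
(** Only the four darts of the two edges may move, so the other darts at [k] and [w] stay put. If
    [w = k] the two edges coincide and this is the identity. *)
Definition swap_darts : {perm dart n} :=
  (tperm (u, e) (u, e') * tperm (k, e) (w, e'))%g.

Let u_k : u != k. Proof. by rewrite -val_eqE ltn_eqF. Qed.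
Let u_w : u != w. Proof. by rewrite -val_eqE ltn_eqF // (leq_trans uk). Qed.

Lemma swap_edgesK : involutive swap_edges.
Proof. exact: tpermK. Qed.

Lemma swap_dartsK : involutive swap_darts.
Proof.
have comm : (tperm (u, e) (u, e') * tperm (k, e) (w, e'))%g
          = (tperm (k, e) (w, e') * tperm (u, e) (u, e'))%g.
  by rewrite conjgC tpermJ !tpermD //= xpair_eqE eq_sym ?(negPf u_k) ?(negPf u_w).
by move=> d; rewrite {2}/swap_darts comm /swap_darts !permM !tpermK.
Qed.

Lemma swap_darts_incident d : d.1 \in ends d.2 ->
  (swap_darts d).1 \in ends (swap_darts d).2 /\
  (swap_darts d).2 = swap_edges d.2.
Proof.
case: d => v a; rewrite permM /swap_edges /=.
have uk' b c : (k, c) != (u, b) :> dart n by rewrite xpair_eqE eq_sym (negPf u_k).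
have uw' b c : (w, c) != (u, b) :> dart n by rewrite xpair_eqE eq_sym (negPf u_w).
have uk'' b c : (u, b) != (k, c) :> dart n by rewrite eq_sym.
have uw'' b c : (u, b) != (w, c) :> dart n by rewrite eq_sym.
have [->|ae] := eqVneq a e.
  rewrite eE !inE => /orP[]/eqP->.
    by rewrite tpermL tpermD // tpermL e'E !inE eqxx.
  by rewrite (tpermD (x := (u, e)) (y := (u, e'))) // !tpermL e'E !inE eqxx orbT.
have [->|ae'] := eqVneq a e'.
  rewrite e'E !inE => /orP[]/eqP->.
    by rewrite tpermR tpermD // tpermR eE !inE eqxx.
  by rewrite (tpermD (x := (u, e)) (y := (u, e'))) // !tpermR eE !inE eqxx orbT.
have ne b c : (b == e) || (b == e') -> (c, b) != (v, a) :> dart n.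
  by rewrite xpair_eqE negb_and => /orP[]/eqP->; rewrite [_ == a]eq_sym ?ae ?ae' orbT.
by rewrite !tpermD ?ne ?eqxx ?orbT // eq_sym.
Qed.

Lemma swap_darts_upper d : (k <= (swap_darts d).1) = (k <= d.1).
Proof.
have t1 : (tperm (u, e) (u, e') d).1 = d.1 by case: tpermP => [->|->|].
rewrite permM -t1; move: {t1}(tperm (u, e) (u, e') d) => d'.
case: tpermP => [->|->|//] /=.
  by rewrite kw leqnn.
by rewrite kw leqnn.
Qed.

Lemma swap_darts_lower d : d.1 < k -> (swap_darts d).1 = d.1.
Proof.
have t1 : (tperm (u, e) (u, e') d).1 = d.1 by case: tpermP => [->|->|].
rewrite permM -t1; move: {t1}(tperm (u, e) (u, e') d) => d'.
case: tpermP => [->|->|//] /=; first by rewrite ltnn.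
by rewrite ltnNge kw.
Qed.

Definition swap_graph := relabel_graph swap_edges.
Definition swap_rot := relabel_rot swap_darts.

Lemma swap_detour G s :
  detour (swap_graph G) k (swap_rot s) = (detour G k s ^ swap_darts)%g.
Proof.
exact: (relabel_detour swap_dartsK swap_edgesK swap_darts_incident
  swap_darts_upper).
Qed.

Lemma swap_below_mass (R : realFieldType) G s :
  below_mass R k (swap_graph G) (swap_rot s) = below_mass R k G s.
Proof.
exact: (below_mass_relabel R G s swap_dartsK swap_edgesK swap_darts_incident
  swap_darts_upper swap_darts_lower).
Qed.

Lemma swap_fixed d : d.1 = k -> d != (k, e) -> swap_darts d = d.
Proof.
move=> dk de; have du b : (u, b) != d.
  by apply: contraNneq u_k => E; rewrite -dk -E.
have dw : (w, e') != d.
  apply: contraNneq de => E; have wk : w = k by rewrite -dk -E.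
  rewrite -E wk xpair_eqE eqxx /=; apply/eqP/val_inj.
  by rewrite /= eE e'E wk.
by rewrite permM !tpermD // eq_sym.
Qed.

Lemma swap_darts_at G d : d.1 = k -> d != (k, e) ->
  (d \in darts_at (swap_graph G) k) = (d \in darts_at G k).
Proof.
move=> dk de; have dG : (d \in darts (swap_graph G)) = (d \in darts G).
  rewrite -{1}(swap_fixed dk de).
  exact: (relabel_darts swap_dartsK swap_edgesK swap_darts_incident).
by apply/darts_atP/darts_atP; rewrite dG.
Qed.

(** Conjugation by the swap redirects the landing dart from [(k, e)] to [(w, e')] and fixes all
    other darts at [k]. The dart [(k, e)] was itself moved, being the image of [x], so no moved dart
    is gained. *)
Lemma swap_moved G s x : x \in moved_darts G k s -> detour G k s x = (k, e) ->
    (k, e) \in darts_at G k ->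
  [/\ x \in moved_darts (swap_graph G) k (swap_rot s),
      detour (swap_graph G) k (swap_rot s) x = (w, e') &
      #|moved_darts (swap_graph G) k (swap_rot s)| <= #|moved_darts G k s|].
Proof.
move=> /setIdP[xG xmov] dx keG; have [_ xk] := darts_atP _ _ _ xG.
have xke : x != (k, e) by rewrite -dx eq_sym.
have xfix := swap_fixed xk xke.
have dx' : detour (swap_graph G) k (swap_rot s) x = (w, e').
  have uk' b : (u, b) != (k, e) by rewrite xpair_eqE (negPf u_k).
  by rewrite -{1}xfix swap_detour permJ dx permM (tpermD (uk' _) (uk' _)) tpermL.
split; [|exact: dx'|].
  apply/setIdP; split; first by rewrite swap_darts_at.
  by rewrite -{1}xfix swap_detour permJ -{2}xfix (inj_eq perm_inj).
apply/subset_leq_card/subsetP=> y /setIdP[yG ymov]; apply/setIdP.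
have [_ yk] := darts_atP _ _ _ yG.
have [->|ye] := eqVneq y (k, e).
  by rewrite -{2 3}dx (inj_eq perm_inj).
rewrite -(swap_darts_at _ yk ye); split; first exact: yG.
move: ymov; rewrite -{1}(swap_fixed yk ye) swap_detour permJ -{2}(swap_fixed yk ye).
by rewrite (inj_eq perm_inj).
Qed.

End Swap.

(** * Comparing returns to [k] with exits at higher vertices *)

Section BelowExpectation.
Variables (R : realType) (n : nat) (p : R) (k : 'I_n).
Hypotheses (p_ge0 : (0 <= p)%R) (p_le1 : (p <= 1)%R).
Implicit Types (G : graph n) (x y : dart n) (u v w : 'I_n).
Implicit Types (r s : {ffun 'I_n -> {perm dart n}}).
Implicit Types (f g : graph n -> {ffun 'I_n -> {perm dart n}} -> R).
Local Open Scope ring_scope.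

Definition below_expect f : R :=
  \sum_(G : graph n) \sum_(s : {ffun 'I_n -> {perm dart n}})
    gnp_mass p G * below_mass R k G s * f G s.

Lemma below_weight_ge0 G s : 0 <= gnp_mass p G * below_mass R k G s.
Proof. by rewrite mulr_ge0 ?gnp_mass_ge0 ?below_mass_ge0. Qed.

Lemma below_expect_le f g :
    (forall G s, supported_below G k s -> f G s <= g G s) ->
  below_expect f <= below_expect g.
Proof.
move=> fg; apply: ler_sum => G _; apply: ler_sum => s _.
have [->|/below_mass_supported/fg le] := eqVneq (below_mass R k G s) 0.
  by rewrite mulr0 !mul0r.
by rewrite ler_wpM2l // below_weight_ge0.
Qed.

Lemma below_expect_sum (I : finType) (P : pred I)
    (F : I -> graph n -> {ffun 'I_n -> {perm dart n}} -> R) :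
  below_expect (fun G s => \sum_(i | P i) F i G s)
    = \sum_(i | P i) below_expect (F i).
Proof.
rewrite exchange_big; apply: eq_bigr => G _; rewrite exchange_big.
by apply: eq_bigr => s _; rewrite mulr_sumr.
Qed.

(* [e0] is only a default value, returned when [u = w]. *)
Definition edge_between (e0 : edge n) u w : edge n := insubd e0 [set u; w].

Lemma ends_edge_between e0 u w : u != w -> ends (edge_between e0 u w) = [set u; w].
Proof. by move=> uw; apply: insubdK; rewrite -topredE /= cards2 uw. Qed.

Lemma edge_between_opposite e0 e v : v \in ends e ->
  edge_between e0 (opposite v e) v = e.
Proof.
move=> ve; have [ov E] := opposite_ends ve; apply: val_inj.
by rewrite /= ends_edge_between // E setUC.
Qed.

(** The detour of [x] arrives at [w] along the edge from [u]; [x.2] only supplies a default edge. *)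
Definition exits_at x u w G s : bool :=
  (x \in moved_darts G k s)
    && (detour G k s x == (w, edge_between x.2 u w)).

(** After reindexing the right side by the swap, which preserves the weights, the terms compare one
    by one. The number of moved darts does not grow and stays positive because of [x], so
    [cycle_rate] does not drop. *)
Lemma swap_expect x u w : (u < k)%N -> (k <= w)%N ->
  below_expect (fun G s =>
      ((x \in returning_darts G k s) && exits_at x u k G s)%:R
      * cycle_rate R #|moved_darts G k s|)
  <= below_expect (fun G s =>
      (exits_at x u w G s)%:R * cycle_rate R #|moved_darts G k s|).
Proof.
move=> uk kw.
have eE : ends (edge_between x.2 u k) = [set u; k].
  by rewrite ends_edge_between // -val_eqE ltn_eqF.
have e'E : ends (edge_between x.2 u w) = [set u; w].
  by rewrite ends_edge_between // -val_eqE ltn_eqF // (leq_trans uk).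
set e := edge_between x.2 u k in eE *; set e' := edge_between x.2 u w in e'E *.
have graphK : involutive (swap_graph e e') := relabel_graphK (swap_edgesK e e').
have rotK : involutive (swap_rot k u w e e').
  exact: (relabel_rotK (swap_dartsK e e' uk kw)).
rewrite [leRHS](reindex_inj (inv_inj graphK)).
apply: ler_sum => G _.
rewrite [leRHS](reindex_inj (inv_inj rotK)).
apply: ler_sum => s _.
rewrite (gnp_mass_relabel p (swap_edges e e') G : gnp_mass p (swap_graph e e' G) = _).
rewrite (swap_below_mass uk kw eE e'E).
apply: ler_wpM2l; first exact: below_weight_ge0.
rewrite /exits_at -/e -/e'.
case: and3P => [[/setIdP[xmov dk] _ /eqP dx]|_]; last first.
  by rewrite mul0r mulr_ge0 ?cycle_rate_ge0.
rewrite dx in dk.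
have [xmov' dx' le] := swap_moved uk kw eE e'E xmov dx dk.
have exits := introT andP (conj xmov' (introT eqP dx')).
rewrite exits; apply: ler_wpM2l; first exact: ler0n.
apply: le_cycle_rate; apply/andP; split; last exact: le.
by rewrite card_gt0; apply/set0Pn; exists x.
Qed.

Definition low_moved_darts G s : {set dart n} :=
  [set x in moved_darts G k s | (opposite k x.2 < k)%N].

Lemma card_upper : #|[pred w : 'I_n | (k <= w)%N]| = (n - k)%N.
Proof.
rewrite -sum1_card -(big_geq_mkord k n xpredT (fun=> 1%N)) /=.
by rewrite sum_nat_const_nat muln1.
Qed.

(** Each return through a neighbour [u] below [k] is traded for n - k exits, one for every [w] from
    [k] on. For a fixed low dart these exits are mutually exclusive. *)
Lemma returning_expect :
  (n - k)%:R * below_expect (fun G s =>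
      #|returning_darts G k s|%:R * cycle_rate R #|moved_darts G k s|)
  <= below_expect (fun G s =>
      #|low_moved_darts G s|%:R * cycle_rate R #|moved_darts G k s|).
Proof.
pose low x := (opposite k x.2 < k)%N.
apply: (@le_trans _ _ ((n - k)%:R * (\sum_(x | low x) \sum_(u : 'I_n | (u < k)%N)
    below_expect (fun G s =>
      ((x \in returning_darts G k s) && exits_at x u k G s)%:R
      * cycle_rate R #|moved_darts G k s|)))).
  rewrite ler_wpM2l // (eq_bigr _ (fun x _ => esym (below_expect_sum _ _))).
  rewrite -below_expect_sum; apply: below_expect_le => G s supp.
  under eq_bigr do rewrite -mulr_suml -natr_sum.
  rewrite -mulr_suml -natr_sum ler_wpM2r ?cycle_rate_ge0 // ler_nat.
  rewrite -sum1_card [leqRHS]big_mkcond [leqLHS]big_mkcond; apply: leq_sum => x _.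
  case: ifP => // xret; have := xret; rewrite in_set => /andP[xmov yk].
  have xk : x \in darts_at G k by move: xmov; rewrite in_set => /andP[].
  have [xlow ylow] := returning_low supp xk yk; rewrite /low xlow.
  have [yG y1] := darts_atP _ _ _ yk.
  have exits : exits_at x (opposite k (detour G k s x).2) k G s.
    apply/andP; split; first exact: xmov.
    apply/eqP; rewrite edge_between_opposite; last first.
      by move: yG; rewrite inE y1 => /andP[].
    by rewrite [LHS]surjective_pairing y1.
  by rewrite (bigD1 _ ylow) exits.
apply: (@le_trans _ _ (\sum_(x | low x) \sum_(u : 'I_n | (u < k)%N)
    \sum_(w : 'I_n | (k <= w)%N) below_expect (fun G s =>
      (exits_at x u w G s)%:R * cycle_rate R #|moved_darts G k s|))).
  rewrite mulr_sumr; apply: ler_sum => x _; rewrite mulr_sumr; apply: ler_sum => u uk.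
  by rewrite -card_upper mulr_natl -sumr_const; apply: ler_sum => w; apply: swap_expect.
under eq_bigr do under eq_bigr do rewrite -below_expect_sum.
under eq_bigr do rewrite -below_expect_sum.
rewrite -below_expect_sum; apply: below_expect_le => G s supp.
under eq_bigr do under eq_bigr do rewrite -mulr_suml -natr_sum.
under eq_bigr do rewrite -mulr_suml -natr_sum.
rewrite -mulr_suml -natr_sum ler_wpM2r ?cycle_rate_ge0 // ler_nat.
rewrite -sum1_card [leqRHS]big_mkcond [leqLHS]big_mkcond; apply: leq_sum => x _.
rewrite [x \in low_moved_darts _ _]in_set andbC -/(low x); case: ifP => //= _.
case: ifP => xmov; last first.
  by rewrite big1 // => u _; rewrite big1 // => w _; rewrite /exits_at xmov.
pose y := detour G k s x.
have one (P : pred 'I_n) a : (\sum_(i | P i) (i == a) <= 1)%N.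
  rewrite big_mkcond (bigD1 a) //= big1 => [|i /negPf->]; last by case: ifP.
  by rewrite addn0 eqxx; case: ifP.
(* The landing dart [y] determines both [w], its vertex, and [u], the other end of its edge. *)
apply: leq_trans (leq_mul (one _ (opposite y.1 y.2)) (one _ y.1)).
rewrite big_distrlr /=; apply: leq_sum => u uk; apply: leq_sum => w kw.
rewrite /exits_at xmov /= mulnb; case: eqP => //= yE.
have uw : u != w by rewrite -val_eqE ltn_eqF // (leq_trans uk).
rewrite /y yE /= eqxx andbT (@oppositeE _ w u) ?eqxx //; first by rewrite eq_sym.
by rewrite ends_edge_between // setUC.
Qed.

End BelowExpectation.

(** * Averages over rotations *)

Local Notation rotsys n := {ffun 'I_n -> {perm dart n}}.

Section Averages.
Variables (R : realType) (n : nat).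
Implicit Types (G : graph n) (x y : dart n) (k u v w : 'I_n).
Implicit Types (r s : rotsys n) (t : {perm dart n}).
Local Open Scope ring_scope.

Lemma sum_rot_mass G v : \sum_t rot_mass R G v t = 1.
Proof.
rewrite -mulr_suml -natr_sum -card_sum_mem divff // pnatr_eq0 -lt0n.
exact: (card_cyclic_on_gt0 (darts_at G v)).
Qed.

Lemma sum_below_mass G k : \sum_(s : rotsys n) below_mass R k G s = 1.
Proof.
rewrite -(bigA_distr_bigA (fun v t =>
  if (v < k)%N then rot_mass R G v t else (t == 1%g)%:R)).
rewrite big1 // => v _; case: (v < k)%N; first exact: sum_rot_mass.
rewrite (bigD1 1%g) //= eqxx [X in _ + X]big1 ?addr0 // => t.
by move=> /negPf->.
Qed.

(** By independence, the rotation at [k] can be averaged after conditioning on those below, while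
    the rotations above [k] integrate to 1. *)
Lemma average_restrict G k (H : rotsys n -> {perm dart n} -> R) :
  \sum_(r : rotsys n) embedding_mass R G r * H (restrict_below k r) (r k)
  = \sum_(s : rotsys n) below_mass R k G s * \sum_t rot_mass R G k t * H s t.
Proof.
have -> : \sum_(r : rotsys n) embedding_mass R G r * H (restrict_below k r) (r k)
    = \sum_(s : rotsys n) \sum_t \sum_(r : rotsys n) embedding_mass R G r
        * ((restrict_below k r == s) && (r k == t))%:R * H s t.
  rewrite exchange_big /= [RHS]exchange_big /=.
  under [RHS]eq_bigr do rewrite exchange_big.
  rewrite [RHS]exchange_big; apply: eq_bigr => r _ /=.
  rewrite (bigD1 (restrict_below k r)) //= (bigD1 (r k)) //= !eqxx mulr1.
  rewrite big1 ?addr0 => [|t /negPf]; last first.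
    by rewrite eq_sym => ->; rewrite mulr0 mul0r.
  rewrite big1 ?addr0 // => s /negPf; rewrite eq_sym => ->.
  by rewrite big1 // => t _; rewrite mulr0 mul0r.
apply: eq_bigr => s _; rewrite mulr_sumr; apply: eq_bigr => t _.
rewrite -mulr_suml mulrA; congr (_ * _).
(* The joint event factors over the vertices: below [k] the rotation is prescribed, at [k] it is
   [t], above [k] it is free. The test on [s v] accounts for restrictions that must be trivial from
   [k] on. *)
pose c v (q : {perm dart n}) : R := if (v < k)%N then (q == s v)%:R
  else (s v == 1%g)%:R * (if v == k then (q == t)%:R else 1).
transitivity (\sum_(r : rotsys n) \prod_v (rot_mass R G v (r v) * c v (r v))).
  apply: eq_bigr => r _; rewrite big_split /=; congr (_ * _).
  have [|] := boolP (_ && _).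
    move=> /andP[/eqP Es /eqP Et]; rewrite big1 // => v _.
    rewrite /c -Es -Et ffunE.
    case: (v < k)%N; first by rewrite eqxx.
    by rewrite eqxx mul1r; case: (v =P k) => [->|//]; rewrite eqxx.
  rewrite negb_and => /orP ne; apply/esym/eqP/prodf_eq0.
  suff [v cv] : exists v, c v (r v) = 0 by exists v; rewrite // cv.
  case: ne => [/eqP ne|rkt]; last by exists k; rewrite /c ltnn eqxx (negPf rkt) mulr0.
  have /existsP[v] : [exists v, restrict_below k r v != s v].
    rewrite -negb_forall; apply/forallP => eqs; apply: ne; apply/ffunP=> v.
    exact/eqP.
  rewrite ffunE => neqv; exists v; rewrite /c; move: neqv; case: ifP => _.
    by move=> /negPf->.
  by rewrite eq_sym => /negPf->; rewrite mul0r.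
rewrite -(bigA_distr_bigA (fun v q => rot_mass R G v q * c v q)).
rewrite (bigD1 k) //= [below_mass _ _ _ _](bigD1 k) //= ltnn [RHS]mulrAC.
have delta v (a : {perm dart n}) : \sum_q rot_mass R G v q * (q == a)%:R
    = rot_mass R G v a.
  rewrite (bigD1 a) //= eqxx mulr1 [X in _ + X]big1 ?addr0 // => q /negPf->.
  by rewrite mulr0.
congr (_ * _).
  rewrite /c ltnn eqxx -delta mulr_sumr; apply: eq_bigr => q _.
  by rewrite mulrCA.
apply: eq_bigr => v vk; rewrite /c; case: (v < k)%N; first exact: delta.
by rewrite (negPf vk) -mulr_suml sum_rot_mass mulr1 mul1r.
Qed.

Lemma face_average G k s : supported_below G k s ->
  \sum_t rot_mass R G k t
      * #|closed_cycles (detour G k s * t) (darts_at G k)|%:R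
  <= ((darts_at G k != set0) && (moved_darts G k s == set0))%:R
     + #|returning_darts G k s|%:R * cycle_rate R #|moved_darts G k s|.
Proof.
move=> supp; set A := darts_at G k; set B := moved_darts G k s.
have BA : B \subset A by apply/subsetP=> x /setIdP[].
have fixed x : x \in A :\: B -> detour G k s x = x.
  move=> /setDP[xA xB]; apply/eqP; apply: contraNT xB => xmov.
  exact/setIdP.
have := sum_closed_cycles R BA fixed; set bound := _ + _ => le.
have N0 : 0 < #|cyclic_on A|%:R :> R by rewrite ltr0n card_cyclic_on_gt0.
rewrite -(ler_pM2l N0); apply: le_trans le.
rewrite mulr_sumr [leRHS]big_mkcond; apply: ler_sum => t _.
rewrite /rot_mass -[rotations_at G k]/(cyclic_on A) mulrA mulrCA divff ?gt_eqF //.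
by rewrite mulr1; case: ifP => _; rewrite ?mul1r ?mul0r.
Qed.

End Averages.

(** * Averages over the graph *)

Section Star.
Variable n : nat.
Implicit Types (G : graph n) (x y : dart n) (k u v w : 'I_n) (e : edge n).
Implicit Types (P : pred 'I_n).

Definition star k P : {set edge n} :=
  [set e : edge n | (k \in ends e) && P (opposite k e)].

Lemma opposite_inj k : {in star k predT &, injective (opposite k)}.
Proof.
move=> e e'; rewrite !inE !andbT => ke ke' E; apply: val_inj => /=.
by have [_ ->] := opposite_ends ke; have [_ ->] := opposite_ends ke'; rewrite E.
Qed.

Lemma card_star k P : #|star k P| = #|[set w : 'I_n | (w != k) && P w]|.
Proof.
have sub : {subset star k P <= star k predT}.
  by move=> e; rewrite !inE => /andP[->].
rewrite -(card_in_imset (sub_in2 sub (@opposite_inj k))); apply: eq_card => w.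
apply/imsetP/idP => [[e]|].
  by rewrite !inE => /andP[ke Pe] ->; have [-> _] := opposite_ends ke.
rewrite inE => /andP[wk Pw].
have c2 : #|[set k; w]| == 2 by rewrite cards2 (eq_sym k) wk.
have opp : opposite k (Edge c2) = w by apply: oppositeE; rewrite 1?eq_sym.
by exists (Edge c2); rewrite ?opp // !inE eqxx opp.
Qed.

Lemma card_darts_at G k P :
  #|[set x in darts_at G k | P (opposite k x.2)]| = #|G :&: star k P|.
Proof.
rewrite -(card_imset (G :&: star k P) (_ : injective (pair k))); last by move=> ? ? [].
apply: eq_card => -[v e]; apply/setIdP/imsetP => [[/darts_atP[]]|[e' + [-> ->]]].
  rewrite inE /= => /andP[eG ve] vk Pe; exists e; last by rewrite -vk.
  by rewrite !inE eG -vk ve vk.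
by rewrite !inE /= eqxx => /and3P[-> ->].
Qed.

Lemma card_darts_atT G k : #|darts_at G k| = #|G :&: star k predT|.
Proof.
rewrite -card_darts_at; apply: eq_card => x; apply/idP/setIdP => [|[]//].
by split.
Qed.

Lemma card_neq k : #|[set w : 'I_n | (w != k) && predT w]| = n.-1.
Proof.
rewrite -[n in RHS]card_ord -(cardC1 k); apply: eq_card => w.
by rewrite !inE andbT.
Qed.

Lemma card_neq_lt k : #|[set w : 'I_n | (w != k) && (w < k)]| = k.
Proof.
rewrite -[RHS]card_ord -(card_image (_ : injective (widen_ord (ltnW (ltn_ord k))))).
  apply: eq_card => w; rewrite !inE; apply/andP/imageP => [[_ wk]|[i _ ->]].
    by exists (Ordinal wk) => //; apply: val_inj.
  by rewrite /= ltn_ord -val_eqE /= ltn_eqF.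
by move=> i j /(congr1 val) /= /val_inj.
Qed.

Lemma card_neq_ge k : #|[set w : 'I_n | (w != k) && (k <= w)]| = n - k.+1.
Proof.
have := card_neq k; rewrite -(cardsID [set w : 'I_n | w < k]).
rewrite (_ : _ :&: _ = [set w : 'I_n | (w != k) && (w < k)]); last first.
  by apply/setP=> w; rewrite !inE andbT.
rewrite card_neq_lt (_ : _ :\: _ = [set w : 'I_n | (w != k) && (k <= w)]); last first.
  by apply/setP=> w; rewrite !inE andbT -leqNgt andbC.
by have := ltn_ord k; lia.
Qed.

Definition no_up_edge k G : bool := G :&: star k (fun w : 'I_n => k <= w) == set0.

End Star.

Section GnpAverages.
Variables (R : realType) (n : nat) (p : R).
Implicit Types (G : graph n) (k u v w : 'I_n) (e : edge n).
Local Open Scope ring_scope.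

Lemma sum_graph_prod (F F' : edge n -> R) :
  \sum_(G : graph n) \prod_e (if e \in G then F e else F' e)
    = \prod_e (F e + F' e).
Proof. by rewrite bigA_distr; apply: eq_bigl => G; rewrite inE. Qed.

Lemma sum_gnp_mass : \sum_(G : graph n) gnp_mass p G = 1.
Proof.
rewrite (sum_graph_prod (fun=> p) (fun=> 1 - p)) big1 // => e _.
by rewrite addrC subrK.
Qed.

Lemma gnp_no_up_edge k :
  \sum_(G : graph n) gnp_mass p G * (no_up_edge k G)%:R = (1 - p) ^+ (n - k.+1).
Proof.
set S := star k (fun w : 'I_n => (k <= w)%N).
(* Giving present edges of [S] weight 0 turns the indicator into a product over edges. *)
transitivity (\sum_(G : graph n) \prod_(e : edge n)
    (if e \in G then (if e \in S then 0 else p) else 1 - p)).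
  apply: eq_bigr => G _; rewrite /no_up_edge -/S.
  case: eqP => [GS|/eqP/set0Pn[e /setIP[eG eS]]]; last first.
    by rewrite mulr0 (bigD1 e) //= eG eS mul0r.
  rewrite mulr1; apply: eq_bigr => e _; case: (boolP (e \in G)) => // eG.
  case: (boolP (e \in S)) => // eS; have := in_set0 e.
  by rewrite -GS inE eG eS.
rewrite (sum_graph_prod (fun e => if e \in S then 0 else p) (fun=> 1 - p)).
rewrite (bigID (mem S)) /= [X in _ * X]big1 ?mulr1 => [|e /negPf->]; last first.
  by rewrite addrC subrK.
rewrite (eq_bigr (fun=> 1 - p)) => [|e ->]; last by rewrite add0r.
by rewrite prodr_const card_star card_neq_ge.
Qed.

(** By exchangeability, every edge at [k] has the same expected share of the degree of [k]. These n
    - 1 shares sum to at most 1, strictly less when degree 0, whose ratio is 0 by convention, has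
    positive weight. *)
Lemma gnp_star_fraction k (P : pred 'I_n) : 0 <= p -> p <= 1 ->
  \sum_(G : graph n) gnp_mass p G
      * (#|G :&: star k P|%:R / #|G :&: star k predT|%:R)
  <= #|[set w : 'I_n | (w != k) && P w]|%:R / n.-1%:R.
Proof.
move=> p0 p1; set S := star k predT.
pose a e := \sum_(G : graph n) gnp_mass p G * ((e \in G)%:R / #|G :&: S|%:R).
have a_le e e' : e \in S -> e' \in S -> a e <= a e'.
  move=> eS e'S; pose t := tperm e e'.
  have tK : involutive (relabel_graph t) by apply: relabel_graphK; apply: tpermK.
  rewrite /a [leRHS](reindex_inj (inv_inj tK)) le_eqVlt; apply/orP; left; apply/eqP.
  apply: eq_bigr => G _; rewrite gnp_mass_relabel.
  have tS : S = relabel_graph t S.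
    apply/eqP; rewrite eqEcard card_imset; last exact: perm_inj.
    rewrite leqnn andbT; apply/subsetP=> f fS; rewrite -[f](tpermK e e') imset_f //.
    by case: tpermP => // ->.
  rewrite {2}tS /relabel_graph -imsetI; last by move=> ? ? _ _; apply: perm_inj.
  rewrite card_imset; last exact: perm_inj.
  suff -> : (e' \in t @: G) = (e \in G) by [].
  by rewrite -{1}(tpermL e e') mem_imset //; apply: perm_inj.
have cS : #|S| = n.-1 by rewrite card_star card_neq.
have sumE (A : {set edge n}) : \sum_(e in A) a e
    = \sum_(G : graph n) gnp_mass p G * (#|G :&: A|%:R / #|G :&: S|%:R).
  rewrite exchange_big; apply: eq_bigr => G _ /=; rewrite -mulr_sumr -mulr_suml.
  rewrite -natr_sum; congr (_ * (_%:R / _)).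
  rewrite -sum1_card [LHS]big_mkcond [RHS]big_mkcond.
  apply: eq_bigr => e _; rewrite in_setI.
  by case: (e \in A); case: (e \in G).
have sumS : \sum_(e in S) a e <= 1.
  rewrite sumE -[leRHS]sum_gnp_mass; apply: ler_sum => G _.
  rewrite ler_piMr ?gnp_mass_ge0 //.
  have [->|z] := eqVneq #|G :&: S| 0%N; first by rewrite mul0r.
  have nz : #|G :&: S|%:R != 0 :> R by rewrite pnatr_eq0.
  by rewrite divff.
have aS e : e \in S -> a e <= n.-1%:R^-1.
  move=> eS; have S0 : 0 < #|S|%:R :> R.
    by rewrite ltr0n card_gt0; apply/set0Pn; exists e.
  rewrite -cS -[leRHS]mul1r ler_pdivlMr // mulr_natr -sumr_const.
  by apply: le_trans sumS; apply: ler_sum => e' e'S; apply: a_le.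
rewrite -sumE -card_star mulr_natl -sumr_const; apply: ler_sum => e eP.
by apply: aS; move: eP; rewrite !inE => /andP[->].
Qed.

Lemma sum_geometric_le : 0 < p -> p <= 1 ->
  \sum_(k < n) (1 - p) ^+ (n - k.+1) <= 1 / p.
Proof.
move=> p0 p1; rewrite (reindex_inj rev_ord_inj) /=.
rewrite (eq_bigr (fun i : 'I_n => (1 - p) ^+ i)); last first.
  by move=> i _; rewrite subnSK // subKn // ltnW.
rewrite ler_pdivlMr // mulrC; have := subrX1 (1 - p) n.
have -> : 1 - p - 1 = - p by ring.
rewrite mulNr => /eqP; rewrite eq_sym -subr_eq0 => /eqP E.
have : 0 <= (1 - p) ^+ n by rewrite exprn_ge0 // subr_ge0.
by lra.
Qed.

End GnpAverages.

(** * Harmonic number estimates *)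

Section Harmonic.
Variable R : realType.
Local Open Scope ring_scope.

Lemma harmonic_sqr_le n : (0 < n)%N -> (harmonic_number R n - 1) ^+ 2 <= n%:R - 1
  /\ 1 <= harmonic_number R n.
Proof.
case: n => // n _.
(* The linear bound n / 2 is carried along to control the cross term when the square is expanded. *)
suff : 0 <= harmonic_number R n.+1 - 1 <= n%:R / 2 /\
       (harmonic_number R n.+1 - 1) ^+ 2 <= n%:R.
  by move=> [/andP[h0 _] h]; rewrite -natr1 addrK h; split=> //; rewrite -subr_ge0.
rewrite /harmonic_number; elim: n => [|n [/andP[IH0 IH1] IH2]].
  by rewrite big_nat1 invr1 subrr mul0r expr0n /= !lexx.
rewrite big_nat_recr //=; set h := \sum_(1 <= j < n.+2) _ in IH0 IH1 IH2 *.
have hE : h + n.+2%:R^-1 - 1 = (h - 1) + n.+2%:R^-1 by ring.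
rewrite hE; move: (h - 1) IH0 IH1 IH2 => a a0 a1 a2.
have nP : 0 < n.+2%:R :> R by rewrite ltr0n.
have i0 : 0 <= n.+2%:R^-1 :> R by rewrite invr_ge0 ltW.
have i1 : n.+2%:R^-1 <= 2^-1 :> R by rewrite lef_pV2 ?posrE ?ltr0n // ler_nat.
have iM : n.+2%:R * n.+2%:R^-1 = 1 :> R by rewrite divff // gt_eqF.
have nE : n.+2%:R = n%:R + 2 :> R by rewrite -addn2 natrD.
have n1E : n.+1%:R = n%:R + 1 :> R by rewrite natr1.
rewrite n1E; rewrite nE in i0 i1 iM *; move: (n%:R + 2)^-1 i0 i1 iM => i i0 i1 iM.
have n0 : 0 <= n%:R :> R by [].
split; first by apply/andP; split; lra.
by nra.
Qed.

(** Writing h for H_n, the sum of k / (n - k) is n (h - 1), and the last factor is 1 + h - 1 / (n -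
    1) - 1 / n for n >= 2. The claim then reduces to (h - 1)^2 <= n - 1, up to a nonnegative
    term. *)
Lemma weighted_sum_le n : (0 < n)%N ->
  \sum_(k < n) ((n - k)%:R^-1 * (k%:R / n.-1%:R
     * (1 + \sum_(1 <= j < n.-1) j%:R^-1))) <= harmonic_number R n ^+ 2.
Proof.
move=> n0; have [sq h1] := harmonic_sqr_le n0.
case: n n0 sq h1 => // -[|m] _ sq h1.
  by rewrite big_ord1 mul0r mul0r mulr0 exprn_ge0 // (le_trans ler01).
set h := harmonic_number R m.+2 in sq h1 *.
set g := 1 + _.
have gE : g = 1 + h - m.+1%:R^-1 - m.+2%:R^-1.
  by rewrite /h /harmonic_number big_nat_recr //= big_nat_recr //= /g; ring.
have mP : 0 < m.+1%:R :> R by rewrite ltr0n.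
have mP2 : 0 < m.+2%:R :> R by rewrite ltr0n.
have -> : \sum_(k < m.+2) ((m.+2 - k)%:R^-1 * (k%:R / m.+1%:R * g))
    = m.+2%:R * (h - 1) / m.+1%:R * g.
  under eq_bigr do rewrite !mulrA.
  rewrite -!mulr_suml; congr (_ / _ * _).
  (* With n = m + 2, this is k / (n - k) = n / (n - k) - 1. *)
  transitivity (\sum_(k < m.+2) (m.+2%:R * (m.+2 - k)%:R^-1 - 1) : R).
    apply: eq_bigr => k _; have km := ltn_ord k.
    have E : k%:R = m.+2%:R - (m.+2 - k)%:R :> R by rewrite natrB 1?ltnW // subKr.
    rewrite [in LHS]E mulrC mulrBl divff //.
    by rewrite pnatr_eq0 subn_eq0 -ltnNge.
  rewrite sumrB -mulr_sumr sumr_const card_ord mulrBr mulr1; congr (_ * _ - _).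
  rewrite /h /harmonic_number big_add1 /= big_mkord (reindex_inj rev_ord_inj) /=.
  by apply: eq_bigr => k _; rewrite subKn.
rewrite gE -(ler_pM2r mP) mulrAC divfK ?gt_eqF //.
have E2 : m.+2%:R * m.+2%:R^-1 = 1 :> R by rewrite divff // gt_eqF.
have E1 : m.+1%:R * m.+1%:R^-1 = 1 :> R by rewrite divff // gt_eqF.
have i0 : 0 <= m.+1%:R^-1 :> R by rewrite invr_ge0 ltW.
have nE : m.+2%:R = m.+1%:R + 1 :> R by rewrite natr1.
rewrite nE addrK in sq; rewrite nE in E2 *.
move: (m.+1%:R) (m.+1%:R^-1) ((m.+1%:R + 1)^-1) => a i j in E1 E2 i0 mP sq *.
have K : (a + 1) * (1 + h - i - j) = (a + 1) * (1 + h) - 2 - i.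
  have -> : (a + 1) * (1 + h - i - j)
    = (a + 1) * (1 + h) - (a * i) - i - (a + 1) * j by ring.
  by rewrite E1 E2; ring.
have ih : 0 <= i * (h - 1) by rewrite mulr_ge0 ?subr_ge0.
(* The right side minus the left side is now a - (h - 1)^2 + i (h - 1), which [sq] and [ih] make
   nonnegative. *)
rewrite [leLHS](_ : _ = (h - 1) * ((a + 1) * (1 + h - i - j))); last by ring.
by rewrite K; nra.
Qed.

End Harmonic.

(** * The bound *)

Section Assembly.
Variables (R : realType) (n : nat) (p : R).
Hypotheses (p_ge0 : (0 <= p)%R) (p_le1 : (p <= 1)%R).
Implicit Types (G : graph n) (x y : dart n) (k u v w : 'I_n) (e : edge n).
Implicit Types (r s : rotsys n).
Local Open Scope ring_scope.

(** All darts going up from [k] are moved, so passing from the darts at [k] to the moved ones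
    removes only low darts and cannot raise the low fraction. The harmonic factor grows with the
    number of moved darts, which is at most n - 1. *)
Lemma low_moved_fraction G k s : supported_below G k s ->
  #|low_moved_darts k G s|%:R * cycle_rate R #|moved_darts G k s|
  <= #|G :&: star k (fun u : 'I_n => (u < k)%N)|%:R / #|G :&: star k predT|%:R
     * (1 + \sum_(1 <= j < n.-1) j%:R^-1).
Proof.
move=> supp; pose low := [set x : dart n | (opposite k x.2 < k)%N].
have movedS : moved_darts G k s \subset darts_at G k.
  by apply/subsetP=> x /setIdP[].
have lowE : low_moved_darts k G s = moved_darts G k s :&: low by apply: setIdE.
rewrite lowE -card_darts_atT -card_darts_at setIdE -/low.
have dif : moved_darts G k s :\: low = darts_at G k :\: low.
  apply/eqP; rewrite eqEsubset setSD //=; apply/subsetP=> x /setDP[xk xlow].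
  apply/setDP; split; last exact: xlow.
  by apply: moved_up => //; move: xlow; rewrite in_set -leqNgt.
have DE := cardsID low (moved_darts G k s); rewrite dif in DE.
have dE := cardsID low (darts_at G k).
have LI : (#|moved_darts G k s :&: low| <= #|darts_at G k :&: low|)%N.
  by rewrite subset_leq_card // setSI.
have dn : (#|darts_at G k| <= n.-1)%N.
  by rewrite card_darts_atT -(card_neq k) -card_star subset_leq_card // subsetIr.
move: DE dE LI dn; set L := #|moved_darts G k s :&: low|.
set D := #|moved_darts G k s|; set Y := #|_ :\: _|; set d := #|darts_at G k|.
set I := #|_ :&: _|; move=> DE dE LI dn.
have [D0|Dpos] := posnP D.
  have -> : L = 0%N by lia.
  rewrite mul0r mulr_ge0 // ?divr_ge0 ?ler0n // addr_ge0 // sumr_ge0 // => j _.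
  by rewrite invr_ge0.
have dpos : (0 < d)%N by lia.
rewrite /cycle_rate mulrCA mulrC; apply: ler_pM.
- by rewrite divr_ge0.
- by rewrite addr_ge0 // sumr_ge0 // => j _; rewrite invr_ge0.
- rewrite ler_pdivrMr ?ltr0n // mulrAC ler_pdivlMr ?ltr0n //.
  by rewrite -!natrM ler_nat; nia.
have Dn : (D <= n.-1)%N by lia.
rewrite lerD2l (big_cat_nat Dpos Dn) /= lerDl sumr_ge0 // => j _.
by rewrite invr_ge0.
Qed.

Lemma all_fixed_no_up G k s : supported_below G k s ->
  ((darts_at G k != set0) && (moved_darts G k s == set0) <=
   (darts_at G k != set0) && no_up_edge k G)%N.
Proof.
move=> supp; case: (darts_at G k != set0) => //=; case: eqP => //= mov0.
rewrite lt0b; apply/eqP/setP=> e; rewrite in_set0; apply/negP=> /setIP[eG].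
rewrite in_set => /andP[ke up].
have xk : (k, e) \in darts_at G k by apply/darts_atP; rewrite inE /= eG ke.
by have := moved_up supp xk up; rewrite mov0 inE.
Qed.

(** The extra face of the empty graph is paid for by vertex 0, which then has no dart and so
    contributes only on the right. *)
Lemma sum_no_up_edge G : (0 < n)%N ->
  ((G == set0) + \sum_k ((darts_at G k != set0) && no_up_edge k G)
    <= \sum_k no_up_edge k G)%N.
Proof.
move=> n0; pose k0 : 'I_n := Ordinal n0.
rewrite (bigD1 k0) //= [leqRHS](bigD1 k0) //= addnA leq_add //; last first.
  by apply: leq_sum => k _; case: (no_up_edge k G); rewrite ?andbF // andbT leq_b1.
have [G0|G0] := eqVneq G set0.
  have -> : darts_at G k0 = set0.
    apply/setP=> x; rewrite in_set0; apply/negP=> /darts_atP[].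
    by rewrite G0 inE inE.
  by rewrite eqxx /no_up_edge G0 set0I eqxx.
rewrite add0n; case: (boolP (no_up_edge _ _)); rewrite ?andbF ?leq_b1 //.
Qed.

Lemma embedding_mass_ge0 G r : 0 <= embedding_mass R G r.
Proof. by apply: prodr_ge0 => v _; apply: rot_mass_ge0. Qed.

Lemma embedding_mass_supported G r : embedding_mass R G r != 0 -> supported G r.
Proof.
move=> /prodf_neq0 nz v; have := nz v isT.
case: (boolP (_ \in _)) => [|_]; last by rewrite mul0r eqxx.
by rewrite inE => /andP[].
Qed.

Lemma sum_embedding_mass G : \sum_(r : rotsys n) embedding_mass R G r = 1.
Proof.
rewrite -(bigA_distr_bigA (fun v t => rot_mass R G v t)) big1 // => v _.
exact: sum_rot_mass.
Qed.

Lemma below_expect_graph k (f : graph n -> R) :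
  below_expect p k (fun G _ => f G) = \sum_(G : graph n) gnp_mass p G * f G.
Proof.
apply: eq_bigr => G _; rewrite -mulr_suml -mulr_sumr.
by rewrite sum_below_mass mulr1.
Qed.

Lemma faces_topped_average G k :
  \sum_(r : rotsys n) embedding_mass R G r * #|faces_topped_at G r k|%:R
  <= \sum_(s : rotsys n) below_mass R k G s *
      (((darts_at G k != set0) && (moved_darts G k s == set0))%:R
       + #|returning_darts G k s|%:R * cycle_rate R #|moved_darts G k s|).
Proof.
pose H s t : R := #|closed_cycles (detour G k s * t) (darts_at G k)|%:R.
apply: (@le_trans _ _ (\sum_(r : rotsys n)
    embedding_mass R G r * H (restrict_below k r) (r k))).
  apply: ler_sum => r _.
  have [->|/embedding_mass_supported supp] := eqVneq (embedding_mass R G r) 0.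
    by rewrite !mul0r.
  apply: ler_wpM2l; first exact: embedding_mass_ge0.
  rewrite ler_nat; exact: card_faces_topped_at.
rewrite average_restrict; apply: ler_sum => s _.
have [->|/below_mass_supported supp] := eqVneq (below_mass R k G s) 0.
  by rewrite !mul0r.
apply: ler_wpM2l; first exact: below_mass_ge0.
exact: face_average.
Qed.

Lemma expected_faces_split : expected_faces n p <=
  \sum_(G : graph n) gnp_mass p G * (G == set0)%:R
  + \sum_k (below_expect p k (fun G s =>
        ((darts_at G k != set0) && (moved_darts G k s == set0))%:R)
     + below_expect p k (fun G s =>
        #|returning_darts G k s|%:R * cycle_rate R #|moved_darts G k s|)).
Proof.
apply: (@le_trans _ _ (\sum_(G : graph n) gnp_mass p G *
   ((G == set0)%:R + \sum_k \sum_(s : rotsys n) below_mass R k G s *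
      (((darts_at G k != set0) && (moved_darts G k s == set0))%:R
       + #|returning_darts G k s|%:R * cycle_rate R #|moved_darts G k s|)))).
  apply: ler_sum => G _; apply: ler_wpM2l; first exact: gnp_mass_ge0.
  apply: (@le_trans _ _ (\sum_(r : rotsys n) embedding_mass R G r *
      ((G == set0)%:R + \sum_k #|faces_topped_at G r k|%:R))).
    apply: ler_sum => r _; apply: ler_wpM2l; first exact: embedding_mass_ge0.
    by rewrite -natr_sum -natrD [leRHS]pmulrn ler_int PoszD faces_le.
  under eq_bigr do rewrite mulrDr mulr_sumr.
  rewrite big_split /= -mulr_suml sum_embedding_mass mul1r lerD2l exchange_big.
  by apply: ler_sum => k _; apply: faces_topped_average.
under eq_bigr do rewrite mulrDr mulr_sumr.
rewrite big_split /= lerD2l exchange_big /= le_eqVlt; apply/orP; left; apply/eqP.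
apply: eq_bigr => k _; rewrite -big_split; apply: eq_bigr => G _ /=.
rewrite mulr_sumr -big_split; apply: eq_bigr => s _ /=.
by rewrite mulrA mulrDr.
Qed.

Lemma returning_expect_le k :
  below_expect p k (fun G s =>
    #|returning_darts G k s|%:R * cycle_rate R #|moved_darts G k s|)
  <= (n - k)%:R^-1 * (k%:R / n.-1%:R * (1 + \sum_(1 <= j < n.-1) j%:R^-1)).
Proof.
have nk : 0 < (n - k)%:R :> R by rewrite ltr0n subn_gt0.
rewrite ler_pdivlMl //; apply: le_trans (returning_expect k p_ge0 p_le1) _.
apply: (@le_trans _ _ _ _ _ (below_expect_le p_ge0 p_le1 (@low_moved_fraction ^~ k))).
rewrite below_expect_graph; under eq_bigr do rewrite mulrA.
rewrite -mulr_suml ler_wpM2r //.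
  by rewrite addr_ge0 // sumr_ge0 // => j _; rewrite invr_ge0.
by rewrite -{2}(card_neq_lt k); apply: gnp_star_fraction.
Qed.

End Assembly.

Local Open Scope ring_scope.

Unset Implicit Arguments.

Theorem theorem1p10 (R : realType) (n : nat) (p : R)
    (n_gt0 : (0 < n)%N) (p_gt0 : 0 < p) (p_le1 : p <= 1) :
  expected_faces n p <= harmonic_number R n ^+ 2 + 1 / p.
Proof.
have p_ge0 := ltW p_gt0.
apply: le_trans (expected_faces_split n p_ge0 p_le1) _.
(* The returning darts give the squared harmonic number; the empty graph and the vertices with no
   moved dart together give 1 / p. *)
rewrite big_split /= addrA addrC lerD //.
  apply: le_trans (weighted_sum_le R n_gt0).
  by apply: ler_sum => k _; apply: returning_expect_le.
apply: le_trans (sum_geometric_le n p_gt0 p_le1).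
under [leRHS]eq_bigr do rewrite -gnp_no_up_edge.
apply: (@le_trans _ _ (\sum_(G : graph n) gnp_mass p G * (G == set0)%:R +
  \sum_(k : 'I_n) \sum_(G : graph n)
     gnp_mass p G * ((darts_at G k != set0) && no_up_edge k G)%:R)).
  rewrite lerD2l; apply: ler_sum => k _; rewrite -(@below_expect_graph _ _ p k).
  apply: below_expect_le => // G s supp; rewrite ler_nat.
  exact: all_fixed_no_up.
rewrite exchange_big [leRHS]exchange_big -big_split; apply: ler_sum => G _ /=.
rewrite -!mulr_sumr -mulrDr ler_wpM2l ?gnp_mass_ge0 //.
by rewrite -!natr_sum -natrD ler_nat sum_no_up_edge.
Qed.
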